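(* (1) There exists a loopless matroid $\mathsf{M}$ such that the sequence of coefficients of $\mathrm{H}_\mathsf{M}^{\mathcal{G}_{\min}}(x)$ is not log-concave. (2) There exists $N$ such that for every $n\ge N$ there is a building set $\mathcal{G}$ on the Boolean matroid $\mathsf{U}_{n,n}$ for which the sequence of coefficients of $\mathrm{H}_{\mathsf{U}_{n,n}}^{\mathcal{G}}(x)$ is not log-concave.
   Context: A matroid $\mathsf{M}=(E,\operatorname{rk})$ is a polymatroid (finite $E$, $\operatorname{rk}:2^E\to\mathbb{Z}_{\ge0}$ with $\operatorname{rk}(\varnothing)=0$, monotone, submodular) with $\operatorname{rk}(A)\le|A|$ for all $A$. Flats: $F$ with $\operatorname{rk}(F\cup\{e\})>\operatorname{rk}(F)$ for $e\notin F$; lattice $\mathcal L(\mathsf{M})$ with join $\vee$; loopless means $\varnothing$ is a flat. The Boolean matroid $\mathsf{U}_{n,n}$ has ground set $[n]$ and $\operatorname{rk}(A)=|A|$. $f(\mathcal{G})$ = inclusion-maximal elements of a set $\mathcal{G}$ of flats, $\mathcal{G}_{\le F}=\{G\in\mathcal{G}:G\subseteq F\}$. A building set is $\mathcal{G}\subseteq\mathcal L(\mathsf{M})\setminus\{\varnothing\}$ such that for every flat $F$ the map $\prod_{G\in f(\mathcal{G}_{\le F})}[\varnothing,G]\to[\varnothing,F]$, $(F_G)\mapsto\bigvee F_G$, is a lattice isomorphism and $\operatorname{rk}(F)=\sum_{G\in f(\mathcal{G}_{\le F})}\operatorname{rk}(G)$. $\mathcal{G}_{\min}$ is the building set of nonempty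 flats $F$ for which $\mathcal L(\mathsf{M}|_F)\cong[\varnothing,F]$ is not isomorphic to a product of two nontrivial lattices (connected flats). The Chow ring $D(\mathsf{M},\mathcal{G})$ is $\mathbb{Q}[x_G:G\in\mathcal{G}]$ (degree-1 generators) modulo the ideal generated by $\big(\prod_{i=1}^m x_{G_i}\big)\big(\sum_{H\in\mathcal{G},H\supseteq G}x_H\big)^{\operatorname{rk}(G)-\operatorname{rk}(\sup(S,G))}$ for each subset $S=\{G_1,\dots,G_m\}\subseteq\mathcal{G}$ and $G\in\mathcal{G}$, where $\sup(S,G)=\bigvee_{G'\in S,\,G'\subsetneq G}G'$; $\mathrm{H}_\mathsf{M}^{\mathcal{G}}(x)=\sum_i\dim D^i(\mathsf{M},\mathcal{G})x^i$. A sequence $(a_0,\dots,a_d)$ is log-concave if $a_i^2\ge a_{i-1}a_{i+1}$ for all $0<i<d$. *)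

(* Defs.v *)
From mathcomp Require Import all_boot all_order all_algebra.
From mathcomp Require Import boolp.
From mathcomp Require Import mpoly.

Set Implicit Arguments.
Unset Strict Implicit.
Unset Printing Implicit Defensive.

Import Order.TTheory GRing.Theory Num.Theory.

Record matroid (E : finType) := Matroid {
  rk :> {set E} -> nat;
  rk0 : rk set0 = 0;
  rkS : forall A B : {set E}, A \subset B -> rk A <= rk B;
  rk_submod : forall A B : {set E}, rk (A :|: B) + rk (A :&: B) <= rk A + rk B;
  rk_card : forall A : {set E}, rk A <= #|A|
}.

Section Flats.

Variables (E : finType) (M : matroid E).

Definition flat (F : {set E}) : bool :=
  [forall e, (e \notin F) ==> (M F < M (e |: F))].

Definition loopless : bool := flat set0.

(* The join of a family of flats in the lattice of flats is [span] of its
   union: the least flat containing every member. *)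
Definition span (A : {set E}) : {set E} :=
  \bigcap_(F : {set E} | flat F && (A \subset F)) F.

Lemma flatI (F1 F2 : {set E}) : flat F1 -> flat F2 -> flat (F1 :&: F2).
Proof.
have aux (F F' : {set E}) e : F' \subset F -> e \notin F -> flat F ->
    M F' < M (e |: F').
  move=> sF'F eF /forallP/(_ e); rewrite eF /= => lt_e.
  have := rk_submod M (e |: F') F.
  have -> : (e |: F') :|: F = e |: F by rewrite -setUA (setUidPr sF'F).
  have -> : (e |: F') :&: F = F'.
    rewrite setIUl (setIidPl sF'F); apply/setUidPr/subsetP => x.
    by rewrite !inE => /andP[/eqP-> xF]; rewrite xF in eF.
  move=> le_s; rewrite -(ltn_add2r (M F)); apply: leq_trans le_s.
  by rewrite addnC ltn_add2r.
move=> fF1 fF2; apply/forallP => e; apply/implyP.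
rewrite inE negb_and => /orP[eF|eF].
  by apply: (@aux F1); rewrite ?subsetIl.
by apply: (@aux F2); rewrite ?subsetIr.
Qed.

Lemma flatT : flat setT.
Proof. by apply/forallP => e; rewrite inE. Qed.

Lemma flat_span (A : {set E}) : flat (span A).
Proof.
by apply: (big_ind flat) => [||F /andP[]//]; [exact: flatT | exact: flatI].
Qed.

Lemma span_min (A F : {set E}) : flat F -> A \subset F -> span A \subset F.
Proof. by move=> fF sAF; apply: bigcap_inf; rewrite fF sAF. Qed.

(* The interval of flats below [F], $[\varnothing, F]$ for a loopless
   matroid. *)
Definition below (F : {set E}) : pred {set E} :=
  fun H => flat H && (H \subset F).

Definition interval (F : {set E}) : Type := {H : {set E} | below F H}.

End Flats.

(* Isomorphisms of lattices, as isomorphisms of the underlying orders. *)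
Definition lattice_iso (S T : Type) (leS : rel S) (leT : rel T) (f : S -> T) :
    Prop :=
  bijective f /\ forall x y : S, leT (f x) (f y) = leS x y.

Section BuildingSets.

Variables (E : finType) (M : matroid E).
Implicit Types (G : {set {set E}}) (F : {set E}).

Definition le_interval F : rel (interval M F) :=
  fun H1 H2 => val H1 \subset val H2.

Definition restrict_le G F : {set {set E}} := [set H in G | H \subset F].

Definition maximal_elts G : {set {set E}} :=
  [set H in G | [forall H' in G, (H \subset H') ==> (H' == H)]].

Definition factor G F : Type :=
  {H : {set E} | H \in maximal_elts (restrict_le G F)}.

Definition interval_prod G F : Type :=
  {dffun forall H : factor G F, interval M (val H)}.

Definition le_interval_prod G F : rel (interval_prod G F) :=
  fun u v => [forall H, le_interval (u H) (v H)].

Lemma join_subproof G F (u : interval_prod G F) (fF : flat M F) :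
  below M F (span M (\bigcup_H val (u H))).
Proof.
rewrite /below flat_span span_min //; apply/bigcupsP => H _.
have /andP[_ /subset_trans] := valP (u H); apply.
by have := valP H; rewrite !inE => /andP[/andP[_]].
Qed.

Definition join_map G F (fF : flat M F) (u : interval_prod G F) :
    interval M F :=
  exist _ (span M (\bigcup_H val (u H))) (join_subproof u fF).

Definition building_set G : Prop :=
  [/\ forall H, H \in G -> flat M H /\ H != set0,
      forall F (fF : flat M F),
        lattice_iso (@le_interval_prod G F) (@le_interval F) (join_map fF)
    & forall F, flat M F ->
        M F = \sum_(H in maximal_elts (restrict_le G F)) M H].

Definition nontrivial_type (T : Type) : Prop := exists x y : T, x <> y.

Definition lattice_decomposable F : Prop :=
  exists (d1 d2 : Order.disp_t) (L1 : latticeType d1) (L2 : latticeType d2)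
         (f : interval M F -> L1 * L2),
    [/\ nontrivial_type L1, nontrivial_type L2
      & lattice_iso (@le_interval F)
          (fun x y : L1 * L2 => (x.1 <= y.1)%O && (x.2 <= y.2)%O) f].

Definition G_min : {set {set E}} :=
  [set F | [&& flat M F, F != set0 & `[< ~ lattice_decomposable F >]]].

End BuildingSets.

Section ChowRing.

Local Open Scope ring_scope.

Variables (E : finType) (M : matroid E) (G : {set {set E}}).

(* The variables of the polynomial ring are numbered by the enumeration of [G]:
   the variable ['X_i] is $x_H$ for [H] the flat [enum_val i]. *)
Local Notation I := 'I_(#|G|).
Local Notation elt i := (@enum_val _ (mem G) i).
Local Notation P := {mpoly rat[#|G|]}.

Definition sup_below (S : {set I}) (g : I) : {set E} :=
  span M (\bigcup_(i in S | elt i \proper elt g) elt i).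

Definition chow_rel (S : {set I}) (g : I) : P :=
  (\prod_(i in S) 'X_i)
  * (\sum_(h : I | elt g \subset elt h) 'X_h)
      ^+ (M (elt g) - M (sup_below S g)).

Definition chow_ideal (p : P) : Prop :=
  exists c : {set I} -> I -> P, p = \sum_S \sum_g c S g * chow_rel S g.

(* The degree [d] component of the Chow ring $\mathbb{Q}[x_H : H \in G]$ modulo
   [chow_ideal] has a basis with [k] elements: the classes of the [b j]. *)
Definition chow_dim (d k : nat) : Prop :=
  exists b : 'I_k -> P,
    [/\ forall j, b j \is d.-homog,
        forall p : P, p \is d.-homog ->
          exists c : 'I_k -> rat, chow_ideal (p - \sum_j c j *: b j)
      & forall c : 'I_k -> rat,
          chow_ideal (\sum_j c j *: b j) -> forall j, c j = 0].

Definition chow_hilbert (h : {poly nat}) : Prop :=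
  forall d : nat, chow_dim d (nth 0%N h d).

End ChowRing.

Definition log_concave (a : seq nat) : Prop :=
  forall i, 0 < i -> i < (size a).-1 ->
    nth 0 a i.-1 * nth 0 a i.+1 <= nth 0 a i ^ 2.

Section BooleanMatroid.

Variable n : nat.

Lemma boolean_rk_submod (A B : {set 'I_n}) :
  #|A :|: B| + #|A :&: B| <= #|A| + #|B|.
Proof. by rewrite cardsUI. Qed.

Definition boolean_matroid : matroid 'I_n :=
  @Matroid _ (fun A => #|A|) (cards0 _) (@subset_leq_card _)
    boolean_rk_submod (fun=> leqnn _).

End BooleanMatroid.

(* Main.v *)
(** Let [R_0 < ... < R_l = E] be a flag of flats of a simple matroid and let
   [G] consist of the atoms, the flag and a set of hyperplanes none of which
   contains [R_0].  After elimination of the atoms, the Chow ring is generated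
   by [y_i = x_(R_i) + ... + x_(R_l)] and the [x_P], [P] a hyperplane, subject
   to [y_0^(rk R_0) = 0], [(y_i - y_(i+1)) y_(i+1)^(rk R_(i+1) - rk R_i) = 0],
   [x_P y_i = x_P x_Q = 0] and [x_P^(rk P) = - y_l^(rk P)]: the flag gives a
   tower of projective bundles, and each hyperplane the blow-up of a point away
   from the flag.  Hence the monomials in [y] below a box, together with the
   powers of the [x_P], span.

   They are independent because of a degree map.  On the polynomials in [y] it
   is the residue of the complete intersection above, which sends a monomial of
   top degree to 1 if the partial sums of its exponents are at most those of the
   box, and to 0 otherwise; each hyperplane contributes a correction term.  The
   pairing of the basis with its complementary monomials is then triangular for
   the comparison of partial sums.

   For [l = 2], flats in the flag far enough apart, and [N] hyperplanes, the
   dimensions in degrees 1, 2, 3 are [N + 3], [N + 6], [N + 10], and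
   [(N + 3)(N + 10) > (N + 6)^2] as soon as [N > 6].

   In the Boolean matroid the flag consists of initial segments and the
   hyperplanes are complements of points of [R_0].  For the minimal building
   set, the connected flats are the flats without separator.  In the nested
   matroid with capacities 4, 7, 10 on sets of 5, 9, 79 elements these are the
   atoms and the three sets; turning seven disjoint bases outside the second set
   into circuit-hyperplanes adds the hyperplanes. *)

Require Import Defs.
From mathcomp Require Import all_boot all_order all_algebra.
From HB Require Import structures.
From mathcomp Require Import boolp mpoly zify ring.

Set Implicit Arguments.
Unset Strict Implicit.
Unset Printing Implicit Defensive.

Import Order.TTheory GRing.Theory Num.Theory.

Local Notation span := Defs.span.
Local Notation interval := Defs.interval.

(** * Partial sums of exponents and residues *)

Lemma coef_mulZXn (R : comNzRingType) (q : {poly R}) (c : R) n d :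
  (c == 0)%R || (d < n) -> ((q * (c *: 'X^n))`_d = 0)%R.
Proof.
rewrite -scalerAr coefZ coefMXn.
by case/orP=> [/eqP->|->]; rewrite ?mul0r ?mulr0.
Qed.

Lemma exprDn_mod (A : comNzRingType) (y z : A) n :
  exists c, ((y + z) ^+ n.+1 = y ^+ n.+1 + z ^+ n.+1 + c * (y * z))%R.
Proof.
elim: n => [|n [c IH]]; first by exists 0%R; rewrite !expr1; ring.
by exists (y ^+ n + z ^+ n + c * (y + z))%R; rewrite exprS IH !exprS; ring.
Qed.

Lemma mnm_neq0 n (m : 'X_{1..n}) :
  m != 0%MM -> exists (i : 'I_n) m', m = (m' + U_(i))%MM.
Proof.
rewrite -mdeg_eq0 mdegE sum_nat_eq0 negb_forall => /existsP[i /= mi].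
by exists i, (m - U_(i))%MM; rewrite submK // lep1mP.
Qed.

Lemma mmap1_0 (A : comNzRingType) n (m : 'X_{1..n}) :
  mmap1 (fun=> 0%R : A) m = (m == 0%MM)%:R%R.
Proof.
have [->|m_neq0] := eqVneq m 0%MM; first exact: mmap11.
have [i [m' ->]] := mnm_neq0 m_neq0.
by rewrite /mmap1 (bigD1 i) //= mnmDE mnm1E eqxx addn1 exprS !mul0r.
Qed.

Lemma leq_mnm_mdeg n (m : 'X_{1..n}) (i : 'I_n) : m i <= mdeg m.
Proof. by rewrite mdegE (bigD1 i) //= leq_addr. Qed.

Lemma card_mdeg n b d : d < b ->
  #|[set m : 'X_{1..n.+1 < b} | mdeg m == d]| = 'C(d + n, d).
Proof.
move=> lt_d; rewrite -size_basis cardE -(size_map val); apply: perm_size.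
apply: uniq_perm; rewrite ?uniq_basis ?(map_inj_uniq val_inj) ?enum_uniq //.
move=> m.
rewrite -basis_cover; apply/mapP/idP => [[m' + ->]|/eqP deg_m].
  by rewrite mem_enum inE.
have lt_m : mdeg m < b by rewrite deg_m.
by exists (BMultinom lt_m); rewrite // mem_enum inE deg_m.
Qed.

Section PartialSums.

Variable n : nat.
Implicit Types (m t : 'X_{1..n}) (i : nat) (j : 'I_n).

Definition psum m i : nat := \sum_(j < n | j <= i) m j.

Lemma psum0 i : psum 0%MM i = 0.
Proof. by rewrite /psum big1 // => j _; rewrite mnm0E. Qed.

Lemma psumD m1 m2 i : psum (m1 + m2)%MM i = psum m1 i + psum m2 i.
Proof. by rewrite /psum -big_split; apply: eq_bigr => j _; rewrite mnmDE. Qed.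

Lemma psum_sum (T : Type) (r : seq T) (Q : pred T) (F : T -> 'X_{1..n}) i :
  psum (\sum_(x <- r | Q x) F x)%MM i = \sum_(x <- r | Q x) psum (F x) i.
Proof.
by apply: (big_morph (psum^~ i)) => [m1 m2|];
  [exact: psumD | exact: psum0].
Qed.

Lemma psum1 j i : psum U_(j)%MM i = (j <= i).
Proof.
rewrite /psum big_mkcond (bigD1 j) //= mnm1E eqxx big1 => [|j' /negbTE ne].
  by case: (j <= i).
by rewrite mnm1E eq_sym ne; case: ifP.
Qed.

Lemma psumMn m k i : psum (m *+ k)%MM i = psum m i * k.
Proof. by rewrite /psum big_distrl; apply: eq_bigr => j _; rewrite mulmnE. Qed.

Lemma psum_mdeg m i : n <= i.+1 -> psum m i = mdeg m.
Proof.
move=> le_n; rewrite mdegE /psum; apply: eq_bigl => j.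
exact: leq_trans (ltn_ord j) le_n.
Qed.

Lemma leq_psum m i1 i2 : i1 <= i2 -> psum m i1 <= psum m i2.
Proof.
move=> le_i; rewrite /psum big_mkcond [leqRHS]big_mkcond; apply: leq_sum => j _.
by case: (leqP j i1) => // le_j; rewrite (leq_trans le_j le_i).
Qed.

Lemma psumS m j : psum m j = psum m j.-1 * (0 < j) + m j.
Proof.
rewrite /psum (bigD1 j) //= addnC; congr (_ + _).
case: (posnP j) => [j0|j_gt0].
  by rewrite muln0 big_pred0 // => j'; rewrite -val_eqE /= j0; case: (val j').
rewrite muln1; apply: eq_bigl => j'.
by rewrite -val_eqE /= andbC -ltn_neqAle -[RHS]ltnS prednK.
Qed.

Lemma psum_inj m1 m2 : (forall j, psum m1 j = psum m2 j) -> m1 = m2.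
Proof.
move=> eq_psum; apply/mnmP => j; have := eq_psum j; rewrite !psumS.
case: (posnP j) => [|j_gt0]; first by rewrite !muln0.
have lt_j : j.-1 < n by apply: leq_ltn_trans (leq_pred j) (ltn_ord j).
by rewrite (eq_psum (Ordinal lt_j)) => /addnI.
Qed.

Definition dominated m t : bool :=
  (mdeg m == mdeg t) && [forall j : 'I_n, psum m j <= psum t j].

Lemma dominatedP m t :
  reflect (mdeg m = mdeg t /\ forall i, psum m i <= psum t i) (dominated m t).
Proof.
apply: (iffP andP) => [[/eqP eq_deg /forallP le_psum]|[-> le_psum]]; last first.
  by split=> //; apply/forallP.
split=> // i; have [lt_i|le_n] := ltnP i n;
  first exact: (le_psum (Ordinal lt_i)).
by rewrite !psum_mdeg ?eq_deg ?leqW.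
Qed.

Lemma dominated_refl m : dominated m m.
Proof. exact/dominatedP. Qed.

Lemma dominatedDl m m1 m2 : dominated (m + m1)%MM (m + m2)%MM = dominated m1 m2.
Proof.
rewrite /dominated !mdegD eqn_add2l; congr (_ && _); apply: eq_forallb => j.
by rewrite !psumD leq_add2l.
Qed.

Lemma dominated_ltn_sum_psum m t : dominated m t -> m != t ->
  \sum_(j < n) psum m j < \sum_(j < n) psum t j.
Proof.
move=> /dominatedP[_ le_psum] ne_m; rewrite ltn_neqAle.
have [-> ->] := leqif_sum (fun (j : 'I_n) (_ : true) => leqif_eq (le_psum j)).
rewrite andbT; apply: contra ne_m => /forallP eq_psum.
by apply/eqP/psum_inj => j; apply/eqP/eq_psum.
Qed.

End PartialSums.

Section Residue.

Local Open Scope ring_scope.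

Variables (n : nat) (t : 'X_{1..n}).
Local Notation Q := {mpoly rat[n]}.
Implicit Types (m : 'X_{1..n}) (p q : Q).

Definition residue p : rat :=
  \sum_(m : 'X_{1..n < (mdeg t).+1} | dominated m t) p@_m.

Fact residue_is_linear : linear_for *%R residue.
Proof.
move=> c p q; rewrite /residue mulr_sumr -big_split; apply: eq_bigr => m _.
by rewrite mcoeffD mcoeffZ.
Qed.

HB.instance Definition _ :=
  GRing.isLinear.Build rat Q rat *%R residue residue_is_linear.

Lemma residueX m : residue 'X_[m] = (dominated m t)%:R.
Proof.
rewrite /residue; case: (boolP (dominated m t)) => [dom_m|ndom_m]; last first.
  rewrite big1 // => m' dom_m'; rewrite mcoeffX; case: eqP => // eq_m.
  by rewrite eq_m dom_m' in ndom_m.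
have lt_m : (mdeg m < (mdeg t).+1)%N by case/andP: dom_m => /eqP->.
rewrite (bigD1 (BMultinom lt_m)) //= mcoeffX eqxx big1 ?addr0 // => m' /andP[_].
by rewrite mcoeffX -val_eqE /= [m == _]eq_sym => /negbTE->.
Qed.

Lemma residue_dominated m q : dominated m t -> residue (q * 'X_[m]) = q@_0.
Proof.
move=> dom_m; rewrite [in LHS](mpolyE q) [in RHS](mpolyE q) mulr_suml
  !linear_sum.
apply: eq_bigr => m' _; rewrite -scalerAl !linearZ /= -mpolyXD residueX mcoeffX.
congr (_ * _%:R); congr nat_of_bool; apply/idP/eqP => [|->];
  last by rewrite add0m.
case/dominatedP=> + _; case/dominatedP: dom_m => <- _; rewrite mdegD => /eqP.
by rewrite -[eqbRHS]add0n eqn_add2r mdeg_eq0 => /eqP.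
Qed.

Definition null p : Prop := forall q, residue (q * p) = 0.

Lemma null_monomials p : (forall m, residue ('X_[m] * p) = 0) -> null p.
Proof.
move=> res0 q; rewrite (mpolyE q) mulr_suml linear_sum big1 // => m _.
by rewrite -scalerAl linearZ /= res0 mulr0.
Qed.

Lemma nullMl q p : null p -> null (q * p).
Proof. by move=> null_p q'; rewrite mulrA. Qed.

Lemma nullZ c p : null p -> null (c *: p).
Proof. by rewrite -mul_mpolyC; apply: nullMl. Qed.

Lemma nullB p q : null p -> null q -> null (p - q).
Proof.
by move=> null_p null_q q'; rewrite mulrBr raddfB /= null_p null_q subr0.
Qed.

Lemma null_psum m i : (psum t i < psum m i)%N -> null 'X_[m].
Proof.
move=> lt_m; apply: null_monomials => m'; rewrite -mpolyXD residueX.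
case: dominatedP => // -[_ /(_ i)]; rewrite psumD.
by move: lt_m; clear; lia.
Qed.

Lemma null_mdeg m : (mdeg t < mdeg m)%N -> null 'X_[m].
Proof. by rewrite -!(@psum_mdeg n _ n) //; apply: null_psum. Qed.

(* Replacing a variable by the next one only changes the [j]-th partial sum, on
   which the [i]-th one already imposes a stronger condition. *)
Lemma null_next_var (j j' : 'I_n) m i : j' = j.+1 :> nat -> (j < i)%N ->
  (psum t i + psum m j <= psum m i + psum t j)%N ->
  null (('X_j - 'X_j') * 'X_[m]).
Proof.
move=> ej' lt_ji le_m; apply: null_monomials => m'.
have le_m' := leq_psum m' (ltnW lt_ji).
rewrite mulrCA -mpolyXD mulrBl -!mpolyXD raddfB /= !residueX.
apply/eqP; rewrite subr_eq0; apply/eqP; congr (_%:R); congr nat_of_bool.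
apply/dominatedP/dominatedP; rewrite !mdegD !mdeg1 => -[eq_deg dom];
  split=> // k.
  apply: leq_trans (dom k); rewrite !psumD !psum1 ej' leq_add2r.
  by case: (ltnP j k) => // /ltnW->.
have := dom k; have := dom i; rewrite !psumD !psum1 ej'.
have [->|] := eqVneq k j; last by clear; lia.
by move: lt_ji le_m le_m'; clear; lia.
Qed.

End Residue.

(** * Ranks, and the ideal of the Chow ring *)

Section Rank.

Variables (E : finType) (M : matroid E).
Implicit Types A B F K : {set E}.

Definition simple_matroid : Prop := loopless M /\ forall e, flat M [set e].

Lemma setUD_sub A B : A \subset B -> A :|: B :\: A = B.
Proof. by move=> sAB; rewrite -{1}(setIidPr sAB) setID. Qed.

Lemma rk_setU_card A B : M (A :|: B) <= M A + #|B|.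
Proof.
apply: leq_trans (leq_trans (leq_addr _ _) (rk_submod M A B)) _.
by rewrite leq_add2l rk_card.
Qed.

Lemma rk_setU1 e A : M (e |: A) <= M A + 1.
Proof. by rewrite setUC -(cards1 e) rk_setU_card. Qed.

Lemma rk_setU_id A B : {in B, forall e, M (e |: A) = M A} -> M (A :|: B) = M A.
Proof.
have [n] := ubnP #|B|; elim: n B => // n IHn B ltB rk_e.
have [->|[e eB]] := set_0Vmem B; first by rewrite setU0.
have rk_D1 : M (A :|: B :\ e) = M A.
  apply: IHn => [|x /setD1P[_ /rk_e] //].
  by move: ltB; rewrite (cardsD1 e B) eB; lia.
have eqU : (A :|: B :\ e) :|: (e |: A) = A :|: B.
  apply/setP => x; rewrite !inE; have [->|_] := eqVneq x e;
    first by rewrite eB !orbT.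
  by do 2?case: (x \in _).
have sAI : A \subset (A :|: B :\ e) :&: (e |: A)
  by rewrite subsetI subsetUl subsetUr.
have := rk_submod M (A :|: B :\ e) (e |: A); rewrite eqU rk_D1 (rk_e e eB).
by have := rkS M sAI; have := rkS M (subsetUl A B); lia.
Qed.

Lemma sub_span A : A \subset span M A.
Proof. by apply/bigcapsP => F /andP[]. Qed.

Lemma span_flat F : flat M F -> span M F = F.
Proof. by move=> fF; apply/eqP; rewrite eqEsubset sub_span span_min. Qed.

Lemma rk_span A : M (span M A) = M A.
Proof.
apply/eqP; rewrite eqn_leq (rkS M (sub_span A)) andbT.
pose C := [set e | M (e |: A) == M A].
have sAC : A \subset C.
  by apply/subsetP => e eA; rewrite inE (setUidPr _) // sub1set.
have rkC : M C = M A.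
  rewrite -[RHS](@rk_setU_id A C) ?(setUidPr sAC) // => e.
  by rewrite inE => /eqP.
have fC : flat M C.
  apply/forallP => e; apply/implyP; rewrite inE => ne.
  rewrite rkC; apply: (@leq_trans (M (e |: A))); last exact/rkS/setUS.
  by rewrite ltn_neqAle eq_sym ne rkS ?subsetUr.
by rewrite -rkC rkS ?span_min.
Qed.

Lemma flat_eq F K : flat M F -> F \subset K -> M K <= M F -> F = K.
Proof.
move=> fF sFK le_rk; apply/eqP; rewrite eqEsubset sFK /=; apply/subsetP => e eK.
apply: contraLR le_rk => neF; rewrite -ltnNge.
move/forallP: fF => /(_ e); rewrite neF /= => /leq_trans; apply.
by rewrite rkS // subUset sub1set eK.
Qed.

Lemma flat_rk_proper F K : flat M F -> F \proper K -> M F < M K.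
Proof.
move=> fF /properP[sFK [e eK neF]]; rewrite ltnNge; apply/negP => le_rk.
by rewrite (flat_eq fF sFK le_rk) eK in neF.
Qed.

Lemma flat_rk_setU1 F A e : flat M F -> A \subset F -> e \notin F ->
  M A < M (e |: A).
Proof.
move=> fF sAF neF; have rkF := forallP fF e; rewrite neF /= in rkF.
have sAI : A \subset (e |: A) :&: F by rewrite subsetI sAF subsetUr.
have := rk_submod M (e |: A) F; rewrite -setUA (setUidPr sAF).
by have := rkS M sAI; move: rkF; clear; lia.
Qed.

Lemma sub_indep A B : A \subset B -> M B = #|B| -> M A = #|A|.
Proof.
move=> sAB iB; apply/eqP; rewrite eqn_leq rk_card /=.
have := rk_setU_card A (B :\: A); rewrite setUD_sub // iB.
by have := cardsID A B; rewrite (setIidPr sAB); lia.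
Qed.

Lemma simple_rk_set1 e : simple_matroid -> M [set e] = 1.
Proof.
case=> /forallP/(_ e) + _; rewrite inE setU0 rk0 => rk_gt0.
by apply/eqP; rewrite eqn_leq -{1}(cards1 e) rk_card.
Qed.

End Rank.

Section ChowIdeal.

Local Open Scope ring_scope.

Variables (E : finType) (M : matroid E) (G : {set {set E}}).
Local Notation P := {mpoly rat[#|G|]}.
Local Notation elt i := (@enum_val _ (mem G) i).
Local Notation ideal := (@chow_ideal E M G).

Lemma chow_ideal0 : ideal 0.
Proof.
exists (fun _ _ => 0); rewrite big1 // => S _; rewrite big1 // => g _.
by rewrite mul0r.
Qed.

Lemma chow_idealD (p q : P) : ideal p -> ideal q -> ideal (p + q).
Proof.
move=> [c ->] [c' ->]; exists (fun S g => c S g + c' S g).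
rewrite -big_split; apply: eq_bigr => S _; rewrite -big_split.
by apply: eq_bigr => g _; rewrite mulrDl.
Qed.

Lemma chow_idealM (q p : P) : ideal p -> ideal (q * p).
Proof.
move=> [c ->]; exists (fun S g => q * c S g); rewrite mulr_sumr.
by apply: eq_bigr => S _; rewrite mulr_sumr; apply: eq_bigr => g _;
  rewrite mulrA.
Qed.

Lemma chow_idealZ (c : rat) (p : P) : ideal p -> ideal (c *: p).
Proof. by rewrite -mul_mpolyC; apply: chow_idealM. Qed.

Lemma chow_idealN (p : P) : ideal p -> ideal (- p).
Proof. by rewrite -scaleN1r; apply: chow_idealZ. Qed.

Lemma chow_idealB (p q : P) : ideal p -> ideal q -> ideal (p - q).
Proof. by move=> Ip Iq; apply/chow_idealD/chow_idealN. Qed.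

Lemma chow_ideal_gen S g : ideal (chow_rel M S g).
Proof.
exists (fun S' g' => ((S' == S) && (g' == g))%:R).
rewrite (bigD1 S) //= (bigD1 g) //= !eqxx mul1r big1 ?addr0 => [|g' /negbTE->].
  rewrite big1 ?addr0 // => S' /negbTE-> /=.
  by rewrite big1 // => g' _; rewrite mul0r.
by rewrite andbF mul0r.
Qed.

Section Evaluation.

Variable A : comAlgType rat.
Implicit Types F : {set E} -> A.

Definition chow_eval F : P -> A := mmap (in_alg A) (fun i => F (elt i)).

HB.instance Definition _ F := GRing.RMorphism.copy (chow_eval F)
  (mmap (in_alg A) (fun i => F (elt i))).

Fact chow_eval_is_scalable F : scalable (chow_eval F).
Proof. by move=> c p; rewrite /chow_eval mmapZ /= mulr_algl. Qed.

HB.instance Definition _ F :=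
  GRing.isScalable.Build rat P A *:%R (chow_eval F) (chow_eval_is_scalable F).

Lemma chow_evalX F i : chow_eval F 'X_i = F (elt i).
Proof. by rewrite /chow_eval mmapX mmap1U. Qed.

End Evaluation.

Definition union_below (S : {set {set E}}) (K : {set E}) : {set E} :=
  \bigcup_(H in S | H \proper K) H.

Lemma union_below_set0 (K : {set E}) : union_below set0 K = set0.
Proof. by rewrite /union_below big_pred0 // => H; rewrite inE. Qed.

Lemma union_below_set1 (H K : {set E}) :
  H \proper K -> union_below [set H] K = H.
Proof. by move=> HK; rewrite /union_below big_mkcondr big_set1 HK. Qed.

(* [chow_rel] with the subsets indexed by [G] itself instead of its
   enumeration, and the variables replaced by the values of [F]. *)
Definition set_rel (A : comNzRingType) (F : {set E} -> A) (S : {set {set E}})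
    (K : {set E}) : A :=
  (\prod_(H in S) F H) * (\sum_(H in G | K \subset H) F H)
    ^+ (M K - M (union_below S K)).

Lemma set_relE (A : comNzRingType) (F : {set E} -> A) (S : {set 'I_#|G|}) g :
  set_rel F [set elt i | i in S] (elt g) =
  (\prod_(i in S) F (elt i))
  * (\sum_(h : 'I_#|G| | elt g \subset elt h) F (elt h))
      ^+ (M (elt g) - M (sup_below M S g)).
Proof.
rewrite /set_rel /union_below big_imset /=;
  last by move=> i j _ _ /enum_val_inj.
rewrite /sup_below rk_span big_imset_cond /=;
  last by move=> i j _ _ /enum_val_inj.
by rewrite big_enum_val_cond.
Qed.

Lemma chow_eval_rel (A : comAlgType rat) (F : {set E} -> A) S g :
  chow_eval F (chow_rel M S g) = set_rel F [set elt i | i in S] (elt g).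
Proof.
rewrite set_relE /chow_rel rmorphM rmorphXn rmorph_prod rmorph_sum /=.
by congr (_ * _ ^+ _); apply: eq_bigr => i _; rewrite chow_evalX.
Qed.

(* [0] unless [H \in G]. *)
Definition xvar (H : {set E}) : P := \sum_(i : 'I_#|G| | elt i == H) 'X_i.

Lemma xvar_elt i : xvar (elt i) = 'X_i.
Proof.
by rewrite /xvar (big_pred1 i) // => j; rewrite (inj_eq enum_val_inj).
Qed.

Lemma chow_relE S g :
  chow_rel M S g = set_rel xvar [set elt i | i in S] (elt g).
Proof.
rewrite set_relE /chow_rel.
by congr (_ * _ ^+ _); apply: eq_bigr => i _; rewrite xvar_elt.
Qed.

Lemma xvarE H (HG : H \in G) : xvar H = 'X_(enum_rank_in HG H).
Proof. by rewrite -xvar_elt enum_rankK_in. Qed.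

Lemma xvar_homog H : H \in G -> xvar H \is 1.-homog.
Proof. by move=> HG; rewrite (xvarE HG) dhomogX /= mdeg1. Qed.

Lemma chow_eval_xvar (A : comAlgType rat) (F : {set E} -> A) H :
  H \in G -> chow_eval F (xvar H) = F H.
Proof. by move=> HG; rewrite (xvarE HG) chow_evalX enum_rankK_in. Qed.

Lemma set_rel_ideal (S : {set {set E}}) K :
  S \subset G -> K \in G -> ideal (set_rel xvar S K).
Proof.
move=> sSG KG; pose S' := [set i | elt i \in S].
have -> : S = [set elt i | i in S'].
  apply/setP => H; apply/idP/imsetP => [HS|[i]]; last by rewrite inE => iS ->.
  have HG := subsetP sSG H HS; exists (enum_rank_in HG H); rewrite ?inE;
  by rewrite enum_rankK_in.
by rewrite -(enum_rankK_in KG KG) -chow_relE; apply: chow_ideal_gen.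
Qed.

Lemma chow_eval_augmentation (A : comAlgType rat) (F : {set E} -> A)
    (eps : {lrmorphism A -> rat | *%R}) (q : P) :
  {in G, forall H, eps (F H) = 0} -> eps (chow_eval F q) = q@_0.
Proof.
move=> eps0; rewrite (mpolyE q) (linear_sum (chow_eval F)) !linear_sum.
apply: eq_bigr => m _.
rewrite !linearZ /= mcoeffX -mmap1_0 /chow_eval mmapX /mmap1 rmorph_prod.
by congr (_ * _); apply: eq_bigr => i _; rewrite rmorphXn /= eps0 ?enum_valP.
Qed.

Section Spanning.

Variables (T : finType) (B : {set T}) (b : T -> P).

Definition chow_spanned (p : P) : Prop :=
  exists c : T -> rat, ideal (p - \sum_(t in B) c t *: b t).

Lemma chow_spanned_ideal p : ideal p -> chow_spanned p.
Proof.
move=> Ip; exists (fun=> 0); rewrite big1 ?subr0 // => t _.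
by rewrite scale0r.
Qed.

Lemma chow_spannedD p q : chow_spanned p -> chow_spanned q ->
  chow_spanned (p + q).
Proof.
move=> [c Ip] [c' Iq]; exists (fun t => c t + c' t).
rewrite (eq_bigr _ (fun t _ => scalerDl (b t) (c t) (c' t))).
by rewrite big_split opprD addrACA; apply: chow_idealD.
Qed.

Lemma chow_spannedZ z p : chow_spanned p -> chow_spanned (z *: p).
Proof.
move=> [c Ip]; exists (fun t => z * c t).
under eq_bigr do rewrite -scalerA.
by rewrite -scaler_sumr -scalerBr; apply: chow_idealZ.
Qed.

Lemma chow_spannedN p : chow_spanned p -> chow_spanned (- p).
Proof. by rewrite -scaleN1r; apply: chow_spannedZ. Qed.

Lemma chow_spanned_congr p q : ideal (p - q) -> chow_spanned q ->
  chow_spanned p.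
Proof. by move/chow_spanned_ideal/chow_spannedD => spq /spq; rewrite subrK. Qed.

Lemma chow_spanned_sum (I : Type) (r : seq I) (Q : pred I) (F : I -> P) :
  (forall i, Q i -> chow_spanned (F i)) ->
  chow_spanned (\sum_(i <- r | Q i) F i).
Proof.
move=> spF; apply: (big_ind chow_spanned) => //; last exact: chow_spannedD.
exact/chow_spanned_ideal/chow_ideal0.
Qed.

Lemma chow_spanned_mem t : t \in B -> chow_spanned (b t).
Proof.
move=> tB; exists (fun u => (u == t)%:R).
rewrite (bigD1 t) //= eqxx scale1r big1 ?addr0 ?subrr; first exact: chow_ideal0.
by move=> u /andP[_ /negbTE->]; rewrite scale0r.
Qed.

Lemma chow_dim_basis d :
  {in B, forall t, b t \is d.-homog} ->
  (forall p, p \is d.-homog -> chow_spanned p) ->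
  (forall c : T -> rat, ideal (\sum_(t in B) c t *: b t) ->
    {in B, forall t, c t = 0}) ->
  chow_dim M G d #|B|.
Proof.
move=> hom_b spanB freeB; exists (fun j => b (enum_val j)); split=> [j|p|c].
- exact/hom_b/enum_valP.
- by case/spanB => c Ip; exists (fun j => c (enum_val j));
    rewrite big_enum_val in Ip.
pose c' t := \sum_(j | enum_val j == t) c j.
have c'E j : c' (enum_val j) = c j.
  by rewrite /c' (big_pred1 j) // => j'; rewrite (inj_eq enum_val_inj).
move=> Ic j; rewrite -c'E; apply: freeB (enum_valP j).
by rewrite big_enum_val; under eq_bigr do rewrite c'E.
Qed.

Lemma chow_free_pairing (deg : {scalar P}) (b' : T -> P) (wt : T -> nat) :
  (forall p, ideal p -> deg p = 0) ->
  {in B, forall t, deg (b' t * b t) != 0} ->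
  {in B &, forall t u, u != t -> deg (b' t * b u) != 0 -> (wt u < wt t)%N} ->
  forall c : T -> rat, ideal (\sum_(t in B) c t *: b t) ->
    {in B, forall t, c t = 0}.
Proof.
move=> deg0 deg_diag deg_tri c Ic t; have [n] := ubnP (wt t).
elim: n t => // n IHn t lt_n tB.
have := deg0 _ (chow_idealM (b' t) Ic); rewrite mulr_sumr linear_sum.
rewrite (bigD1 t) //= big1 => [|u /andP[uB ne_ut]].
  rewrite addr0 -scalerAr linearZ => /eqP.
  by rewrite mulf_eq0 (negbTE (deg_diag t tB)) orbF => /eqP.
rewrite -scalerAr linearZ /=.
have [->|/(deg_tri t u tB uB ne_ut) lt_ut] := eqVneq (deg (b' t * b u)) 0.
  exact: mulr0.
by rewrite IHn ?mul0r // (leq_trans lt_ut).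
Qed.

End Spanning.

End ChowIdeal.

(** * A flag and hyperplanes *)

Section FlagAndHyperplanes.

Variables (E : finType) (M : matroid E) (l : nat) (R : nat -> {set E}).
Variable hyps : {set {set E}}.
Implicit Types (e : E) (i j : nat) (A B K H P : {set E}) (S : {set {set E}}).

Definition atoms_flag_hyps : {set {set E}} :=
  [set [set e] | e : E] :|: [set R i | i : 'I_l.+1] :|: hyps.

Local Notation G := atoms_flag_hyps.

Hypothesis simpleM : simple_matroid M.
Hypothesis rkT : 2 < M setT.
Hypotheses (flatR : forall i, flat M (R i)) (rkR0 : 1 < M (R 0)).
Hypotheses (properR : forall i, i < l -> R i \proper R i.+1).
Hypotheses (R_top : forall i, l <= i -> R i = setT).
Hypothesis flat_hyps : {in hyps, forall P, flat M P}.
Hypothesis rk_hyps : {in hyps, forall P, (M P).+1 = M setT}.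
Hypothesis R0_hyps : {in hyps, forall P, ~~ (R 0 \subset P)}.

Lemma flag_sub i j : i <= j -> R i \subset R j.
Proof.
elim: j => [|j IHj]; first by rewrite leqn0 => /eqP->.
rewrite leq_eqVlt ltnS => /predU1P[->//|/IHj/subset_trans]; apply.
have [/properR/proper_sub//|le_l] := ltnP j l.
by rewrite (R_top (leqW le_l)) subsetT.
Qed.

Lemma flag_rk_lt i j : i < j -> i < l -> M (R i) < M (R j).
Proof.
move=> lt_ij lt_il; apply: flat_rk_proper (flatR i) _.
exact: proper_sub_trans (properR lt_il) (flag_sub lt_ij).
Qed.

Lemma flag_rk_le i j : i <= j -> M (R i) <= M (R j).
Proof. by move=> le_ij; apply/rkS/flag_sub. Qed.

Lemma flag_rk_gt1 i : 1 < M (R i).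
Proof. exact: leq_trans rkR0 (flag_rk_le (leq0n i)). Qed.

Lemma rk_top : M (R l) = M setT.
Proof. by rewrite R_top. Qed.

Definition level K : nat := find (fun i => K \subset R i) (iota 0 l).

Lemma level_max K : level K <= l.
Proof. by rewrite -[leqRHS](size_iota 0) find_size. Qed.

Lemma sub_flagE K i : (K \subset R i) = (level K <= i).
Proof.
have [le_i|lt_i] := leqP (level K) i.
  have [lt_l|le_l] := ltnP (level K) l; last first.
    by rewrite R_top ?subsetT // (leq_trans le_l).
  apply: subset_trans (flag_sub le_i).
  have := @nth_find _ 0 (fun i => K \subset R i) (iota 0 l).
  by rewrite has_find size_iota nth_iota // add0n; apply.
have := before_find 0 lt_i.
by rewrite nth_iota ?add0n // (leq_trans lt_i (level_max K)).
Qed.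

Lemma level_flag i : i <= l -> level (R i) = i.
Proof.
move=> le_i; apply/eqP; rewrite eqn_leq -sub_flagE subxx /= leqNgt.
apply/negP => lt_i; have := flag_rk_lt lt_i (leq_trans lt_i le_i).
by rewrite ltnNge rkS // sub_flagE.
Qed.

Lemma flag_inj : {in [pred i | i <= l] &, injective R}.
Proof. by move=> i j le_i le_j /(congr1 level); rewrite !level_flag. Qed.

Lemma flag_nsub_hyp i P : P \in hyps -> ~~ (R i \subset P).
Proof. by move=> /R0_hyps; apply: contra; apply/subset_trans/flag_sub. Qed.

Lemma hyp_rk_gt1 P : P \in hyps -> 1 < M P.
Proof. by move/rk_hyps=> rkP; rewrite -ltnS rkP. Qed.

Lemma rk_top_pred P : P \in hyps -> (M setT).-1 = M P.
Proof. by move/rk_hyps <-. Qed.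

Lemma hyp_neqT P : P \in hyps -> P != setT.
Proof. by move=> /rk_hyps; apply: contra_eqN => /eqP->; rewrite gtn_eqF. Qed.

Lemma hyp_proper P : P \in hyps -> P \proper setT.
Proof. by move=> hP; rewrite properT hyp_neqT. Qed.

Lemma level_hyp P : P \in hyps -> level P = l.
Proof.
move=> hP; apply/eqP; rewrite eqn_leq level_max leqNgt; apply/negP => lt_l.
have sP : P \subset R (level P) by rewrite sub_flagE.
have eP : P = R (level P).
  apply: flat_eq (flat_hyps hP) sP _.
  by rewrite -ltnS (rk_hyps hP) -rk_top flag_rk_lt.
by have := flag_nsub_hyp (level P) hP; rewrite -eP subxx.
Qed.

Lemma hyp_sub P K : P \in hyps -> K \in hyps -> (P \subset K) = (P == K).
Proof.
move=> hP hK; apply/idP/eqP => [sPK|->//]; apply: flat_eq (flat_hyps hP) sPK _.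
by rewrite -ltnS (rk_hyps hP) rk_hyps.
Qed.

Lemma rk_atom e : M [set e] = 1.
Proof. exact: simple_rk_set1. Qed.

Lemma atom_in e : [set e] \in G.
Proof. by rewrite !inE imset_f. Qed.

Lemma flag_in i : i <= l -> R i \in G.
Proof.
rewrite -ltnS => lt_i; apply/setUP; left; apply/setUP; right; apply/imsetP.
by exists (Ordinal lt_i).
Qed.

Lemma hyp_in P : P \in hyps -> P \in G.
Proof. by rewrite inE => ->; rewrite orbT. Qed.

Lemma top_in : setT \in G.
Proof. by rewrite -(R_top (leqnn l)) flag_in. Qed.

Variant atoms_flag_hyps_spec : {set E} -> Prop :=
  | Atom e : atoms_flag_hyps_spec [set e]
  | Flag i of i <= l : atoms_flag_hyps_spec (R i)
  | Hyperplane P of P \in hyps : atoms_flag_hyps_spec P.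

Lemma atoms_flag_hypsP H : H \in G -> atoms_flag_hyps_spec H.
Proof.
case/setUP => [/setUP[]/imsetP[x _ ->]|]; [exact: Atom | | exact: Hyperplane].
exact: (Flag (ltn_ord x)).
Qed.

Lemma atoms_flag_hyps_flat H : H \in G -> flat M H.
Proof.
by case/atoms_flag_hypsP => [e|i _|P /flat_hyps]; first by case: simpleM.
Qed.

Lemma atoms_flag_hyps_neq0 H : H \in G -> H != set0.
Proof.
move=> HG; suff: 0 < M H by apply: contraTneq => ->; rewrite rk0.
case/atoms_flag_hypsP: HG => [e|i _|P hP]; first by rewrite rk_atom.
  exact: ltnW (flag_rk_gt1 i).
exact: ltnW (hyp_rk_gt1 hP).
Qed.

Lemma rk_gt1_card K : 1 < M K -> (#|K| == 1) = false.
Proof. by move=> rkK; apply/gtn_eqF/(leq_trans rkK)/rk_card. Qed.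

Lemma card1_flag i : (#|R i| == 1) = false.
Proof. exact/rk_gt1_card/flag_rk_gt1. Qed.

Lemma card1_hyp P : P \in hyps -> (#|P| == 1) = false.
Proof. by move/hyp_rk_gt1/rk_gt1_card. Qed.

Lemma big_atoms_flag_hyps (T : Type) (idx : T) (op : Monoid.com_law idx)
    (C : pred {set E}) (F : {set E} -> T) :
  \big[op/idx]_(H in G | C H) F H =
  op (op (\big[op/idx]_(e | C [set e]) F [set e])
    (\big[op/idx]_(i < l.+1 | C (R i)) F (R i)))
    (\big[op/idx]_(P in hyps | C P) F P).
Proof.
have bigUI (A B : {set {set E}}) (F' : {set E} -> T) :
    (forall H, H \in A -> H \notin B) ->
    \big[op/idx]_(H in A :|: B) F' H =
    op (\big[op/idx]_(H in A) F' H) (\big[op/idx]_(H in B) F' H).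
  move=> dis; rewrite -bigU /=; first by apply: eq_bigl => H; rewrite !inE.
  by rewrite disjoint_subset; apply/subsetP.
rewrite big_mkcondr bigUI => [|H]; last first.
  case/setUP => /imsetP[x _ ->]; apply/negP => hP.
    by have := card1_hyp hP; rewrite cards1.
  by have := flag_nsub_hyp x hP; rewrite subxx.
rewrite bigUI => [|_ /imsetP[e _ ->]]; last first.
  by apply/imsetP => -[i _ eR]; have := card1_flag i; rewrite -eR cards1.
rewrite big_imset /=; last by move=> x y _ _ /set1_inj.
rewrite big_imset /=; last first.
  by move=> i j _ _ /flag_inj eq_ij; apply/val_inj/eq_ij; rewrite inE -ltnS.
by rewrite -!big_mkcond -big_mkcondr.
Qed.

Local Open Scope ring_scope.

Lemma sum_above (V : nmodType) (F : {set E} -> V) K : K \in G ->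
  \sum_(H in G | K \subset H) F H =
    (if #|K| == 1%N then F K else 0) + \sum_(level K <= i < l.+1) F (R i)
    + \sum_(P in hyps | K \subset P) F P.
Proof.
move=> KG; rewrite big_atoms_flag_hyps /= big_geq_mkord; congr (_ + _ + _).
  case: eqP => [/eqP/cards1P[x ->]|ne1].
    by rewrite (big_pred1 x) // => e; rewrite sub1set inE eq_sym.
  rewrite big_pred0 // => e; apply/negP; rewrite subset1.
  case/orP => [/eqP eK|]; last by rewrite (negbTE (atoms_flag_hyps_neq0 KG)).
  by rewrite eK cards1 in ne1.
by apply: eq_bigl => i; rewrite sub_flagE.
Qed.

Local Notation Qflag := {mpoly rat[l.+1]}.

Definition flag_var i : Qflag := if (i <= l)%N then 'X_(inord i) else 0.

(* The hyperplanes vanish, the flag gives the [x_(R i)], and the linear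
   relations then force the values of the atoms. *)
Definition flag_val H : Qflag :=
  if #|H| == 1%N then - flag_var (level H)
  else if H == R (level H) then flag_var (level H) - flag_var (level H).+1
  else 0.

Lemma flag_val_atom e : flag_val [set e] = - flag_var (level [set e]).
Proof. by rewrite /flag_val cards1. Qed.

Lemma flag_val_flag i : (i <= l)%N ->
  flag_val (R i) = flag_var i - flag_var i.+1.
Proof. by move=> le_i; rewrite /flag_val card1_flag level_flag ?eqxx. Qed.

Lemma flag_val_hyp P : P \in hyps -> flag_val P = 0.
Proof.
move=> hP; rewrite /flag_val card1_hyp // level_hyp // R_top //.
by rewrite (negbTE (hyp_neqT hP)).
Qed.

Lemma telescope_flag_var i : (i <= l)%N ->
  \sum_(i <= j < l.+1) (flag_var j - flag_var j.+1) = flag_var i.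
Proof.
move=> le_i; rewrite (telescope_sumr_eq (fun j => - flag_var j)) ?leqW //.
  by rewrite {1}/flag_var ltnn oppr0 add0r opprK.
by move=> j _; rewrite opprK addrC.
Qed.

Lemma flag_val_sum K : K \in G ->
  \sum_(H in G | K \subset H) flag_val H =
    if #|K| == 1%N then 0 else flag_var (level K).
Proof.
move=> KG; rewrite sum_above // [X in _ + X]big1 => [|P /andP[/flag_val_hyp]//].
rewrite addr0 -(telescope_flag_var (level_max K)).
under [X in _ + X = _]eq_big_nat => i /andP[_ le_i] do rewrite flag_val_flag //.
case: ifP => [K1|_]; last by rewrite add0r.
by rewrite telescope_flag_var ?level_max // /flag_val K1 addNr.
Qed.

Definition atoms_of S : {set E} := [set e | [set e] \in S].

Definition level_mnm A : 'X_{1..l.+1} :=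
  (\sum_(e in A) U_(inord (level [set e])))%MM.

Lemma psum_level_mnm A i : psum (level_mnm A) i = #|A :&: R i|.
Proof.
rewrite psum_sum -sum1_card; under [RHS]eq_bigl do rewrite inE.
rewrite [RHS]big_mkcondr; apply: eq_bigr => e _.
by rewrite psum1 inordK ?ltnS ?level_max // -sub_flagE sub1set;
  case: (e \in R i).
Qed.

Lemma prod_flag_val S : S \subset G -> [disjoint S & hyps] ->
  \prod_(H in S) flag_val H =
  (-1) ^+ #|atoms_of S| *: 'X_[level_mnm (atoms_of S)]
  * \prod_(i < l.+1 | R i \in S) (flag_var i - flag_var i.+1).
Proof.
move=> sSG dSh; rewrite (eq_bigl (fun H => (H \in G) && (H \in S))); last first.
  by move=> H; rewrite andb_idl // => /(subsetP sSG).
rewrite big_atoms_flag_hyps /= [X in _ * X]big_pred0 ?mulr1; last first.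
  by move=> P; apply/andP => -[hP /(disjointFr dSh)]; rewrite hP.
congr (_ * _); last by apply: eq_bigr => i _; rewrite flag_val_flag // -ltnS.
rewrite (big_morph (fun m => 'X_[m] : Qflag) (@mpolyXD _ _) (@mpolyX0 _ _)).
rewrite -mulr_algl -[_%:A]in_algE rmorphXn rmorphN1 -prodrN.
apply: eq_big => e; first by rewrite inE.
by rewrite flag_val_atom /flag_var level_max.
Qed.

Definition flag_box : 'X_{1..l.+1} :=
  [multinom (if val i is i'.+1 then M (R i) - M (R i') else (M (R 0)).-1)
   | i < l.+1].

Lemma psum_flag_box i : psum flag_box i = (M (R i)).-1.
Proof.
have low j : (j <= l)%N -> psum flag_box j = (M (R j)).-1.
  elim: j => [|j IHj] lt_j.
    by rewrite (psumS _ (@Ordinal l.+1 0 isT)) mnmE muln0.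
  rewrite (psumS _ (@Ordinal l.+1 j.+1 lt_j)) mnmE /= muln1.
  rewrite IHj ?(ltnW lt_j) //; have := flag_rk_gt1 j.
  by have := flag_rk_lt (ltnSn j) lt_j; clear; lia.
have [/low//|lt_i] := leqP i l.
rewrite psum_mdeg ?leqW // -(@psum_mdeg _ _ l) // low //.
by rewrite !R_top // ltnW.
Qed.

Lemma mdeg_flag_box : mdeg flag_box = (M setT).-1.
Proof. by rewrite -(@psum_mdeg _ _ l) // psum_flag_box rk_top. Qed.

Local Notation null := (null flag_box).
Local Notation flag_rel := (set_rel M G flag_val).

Lemma rk_union_below S K B : S \subset G ->
  (forall H, H \in S -> H \proper K -> (1 < M H)%N -> H \subset B) ->
  (M (union_below S K) <= M B + #|(atoms_of S :&: K) :\: B|)%N.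
Proof.
move=> sSG sub_B; apply: leq_trans (rk_setU_card M B _); apply: rkS.
apply/bigcupsP => H /andP[HS HK].
have [rkH|] := ltnP 1 (M H).
  by rewrite (subset_trans (sub_B H HS HK rkH)) ?subsetUl.
have spec_H := atoms_flag_hypsP (subsetP sSG H HS).
case: H / spec_H HS HK => [e|i _|P hP] HS HK.
- move/proper_sub: HK; rewrite !sub1set !inE HS => ->.
  by case: (e \in B).
- by rewrite leqNgt flag_rk_gt1.
- by rewrite leqNgt hyp_rk_gt1.
Qed.

Lemma union_below_atom S e : S \subset G -> union_below S [set e] = set0.
Proof.
move=> sSG; rewrite /union_below big_pred0 // => H; apply/andP => -[HS].
rewrite properEneq subset1 => /andP[/negbTE-> /=].
by rewrite (negbTE (atoms_flag_hyps_neq0 (subsetP sSG _ HS))).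
Qed.

Definition flag_rel_mnm S K : 'X_{1..l.+1} :=
  (level_mnm (atoms_of S)
   + U_(inord (level K)) *+ (M K - M (union_below S K)))%MM.

Lemma psum_flag_rel_mnm S K i : psum (flag_rel_mnm S K) i =
  (#|atoms_of S :&: R i| + (K \subset R i) * (M K - M (union_below S K)))%N.
Proof.
by rewrite psumD psumMn psum1 psum_level_mnm inordK ?ltnS ?level_max //
  sub_flagE.
Qed.

Lemma mdeg_flag_rel_mnm S K : mdeg (flag_rel_mnm S K) =
  (#|atoms_of S| + (M K - M (union_below S K)))%N.
Proof.
rewrite -(@psum_mdeg _ _ l) // psum_flag_rel_mnm R_top // setIT subsetT.
by rewrite mul1n.
Qed.

Lemma flag_relE S K : S \subset G -> [disjoint S & hyps] -> K \in G ->
  (1 < M K)%N ->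
  flag_rel S K = (-1) ^+ #|atoms_of S|
    *: (\prod_(i < l.+1 | R i \in S) (flag_var i - flag_var i.+1)
        * 'X_[flag_rel_mnm S K]).
Proof.
move=> sSG dSh KG rkK; rewrite /set_rel prod_flag_val // flag_val_sum //.
rewrite (rk_gt1_card rkK) {3}/flag_var level_max mpolyXn.
by rewrite /flag_rel_mnm mpolyXD -!scalerAl mulrA [\prod_(_ | _) _ * _]mulrC.
Qed.

Lemma null_flag_rel_atom S e : S \subset G -> null (flag_rel S [set e]).
Proof.
move=> sSG q; rewrite /set_rel flag_val_sum ?atom_in // cards1.
by rewrite union_below_atom // rk0 rk_atom expr1 !mulr0 linear0.
Qed.

Lemma null_flag_rel_hyp_mem S K P : P \in S -> P \in hyps ->
  null (flag_rel S K).
Proof.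
move=> PS hP q; rewrite /set_rel (bigD1 P) //= flag_val_hyp //.
by rewrite !mul0r mulr0 linear0.
Qed.

Lemma null_prod_flag_var (Q : pred 'I_l.+1) (i : 'I_l.+1) p : Q i ->
  null ((flag_var i - flag_var i.+1) * p) ->
  null (\prod_(j | Q j) (flag_var j - flag_var j.+1) * p).
Proof.
by move=> Qi null_p; rewrite (bigD1 i) //= mulrAC mulrC;
  apply: nullMl.
Qed.

Lemma flag_below S i H : S \subset G -> [disjoint S & hyps] -> H \in S ->
  H \proper R i -> (1 < M H)%N -> exists2 j, (j < i)%N && (R j \in S) & H = R j.
Proof.
move=> sSG dSh HS prop rkH; have nhH := disjointFr dSh HS.
have spec_H := atoms_flag_hypsP (subsetP sSG H HS).
case: H / spec_H HS prop rkH nhH => [e|j _|P ->//] HS prop;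
  first by rewrite rk_atom.
exists j; rewrite // HS andbT ltnNge; apply: contra (proper_subn prop).
exact: flag_sub.
Qed.

Lemma null_flag_rel_flag_min S i : S \subset G -> [disjoint S & hyps] ->
  (i <= l)%N -> (forall j, (j < i)%N -> R j \notin S) ->
    null (flag_rel S (R i)).
Proof.
move=> sSG dSh le_i no_flag; rewrite flag_relE ?flag_in ?flag_rk_gt1 //.
apply/nullZ/nullMl/(@null_psum _ _ _ i).
rewrite psum_flag_box psum_flag_rel_mnm subxx.
have no_below H : H \in S -> H \proper R i -> (1 < M H)%N -> H \subset set0.
  by move=> HS HR /(flag_below sSG dSh HS HR)[j /andP[/no_flag/negbTE->]].
have := rk_union_below sSG no_below; rewrite rk0 setD0.
by have := flag_rk_gt1 i; clear; lia.
Qed.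

Lemma null_flag_rel_flag_max S i j : S \subset G -> [disjoint S & hyps] ->
  (i <= l)%N -> (j < i)%N -> R j \in S ->
  (forall k, (k < i)%N -> R k \in S -> (k <= j)%N) -> null (flag_rel S (R i)).
Proof.
move=> sSG dSh le_i lt_j RjS max_j; have lt_jl := leq_trans lt_j le_i.
have eq_j : (inord j : 'I_l.+1) = j :> nat by rewrite inordK // ltnS ltnW.
rewrite flag_relE ?flag_in ?flag_rk_gt1 //; apply: nullZ.
apply: (null_prod_flag_var (i := inord j)); rewrite eq_j //.
rewrite /flag_var lt_jl (ltnW lt_jl).
apply: (@null_next_var _ _ (inord j) (inord j.+1) _ i); rewrite eq_j ?inordK //.
rewrite !psum_flag_box !psum_flag_rel_mnm subxx.
have -> : R i \subset R j = false.
  by apply/negbTE; rewrite sub_flagE level_flag // -ltnNge.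
have below_j H : H \in S -> H \proper R i -> (1 < M H)%N -> H \subset R j.
  move=> HS HR /(flag_below sSG dSh HS HR)[k /andP[lt_k RkS] ->].
  exact/flag_sub/max_j.
have := rk_union_below sSG below_j; have := flag_rk_lt lt_j lt_jl.
have := cardsID (R j) (atoms_of S :&: R i).
rewrite -setIA (setIidPr (flag_sub (ltnW lt_j))).
by have := flag_rk_gt1 j; clear; lia.
Qed.

Lemma null_flag_rel_flag S i : S \subset G -> [disjoint S & hyps] ->
  (i <= l)%N ->
  null (flag_rel S (R i)).
Proof.
move=> sSG dSh le_i; pose Q (j : 'I_i) := R j \in S.
case: (pickP Q) => [j0 Qj0|no_flag]; last first.
  apply: null_flag_rel_flag_min => // j lt_j;
    exact/negbT/(no_flag (Ordinal lt_j)).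
case: (@arg_maxnP _ j0 Q (@nat_of_ord i) Qj0) => j RjS max_j.
apply: null_flag_rel_flag_max le_i (ltn_ord j) RjS _ => // k lt_k.
exact: (max_j (Ordinal lt_k)).
Qed.

Lemma union_below_atoms S K : S \subset [set [set e] | e : E] -> (1 < M K)%N ->
  union_below S K = atoms_of S :&: K.
Proof.
move=> sSa rkK; apply/setP => e; rewrite !inE; apply/bigcupP/andP.
  case=> H /andP[HS /proper_sub HK] eH; move: HK.
  have [x _ eqH] := imsetP (subsetP sSa H HS); move: HS eH; rewrite eqH sub1set.
  by move=> xS /set1P->.
case=> eS eK; exists [set e]; rewrite ?set11 // eS properEneq sub1set eK andbT.
by apply: contraTneq rkK => <-; rewrite rk_atom.
Qed.

Lemma sub_atoms_flag_notin S i : S \subset [set [set e] | e : E] ->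
  R i \notin S.
Proof.
move=> sSa; apply/negP => /(subsetP sSa)/imsetP[e _ eR].
by have := card1_flag i; rewrite eR cards1.
Qed.

Lemma null_flag_var i m : (mdeg flag_box <= mdeg m)%N ->
  null (flag_var i * 'X_[m]).
Proof.
move=> le_m; rewrite /flag_var; case: ifP => _;
  last by move=> q; rewrite mul0r mulr0 linear0.
by rewrite -mpolyXD; apply: null_mdeg; rewrite mdegD mdeg1 add1n ltnS.
Qed.

Lemma hyp_below S P H : S \subset G -> [disjoint S & hyps] -> P \in hyps ->
  H \in S -> H \proper P -> (M H <= 1)%N.
Proof.
move=> sSG dSh hP HS /proper_sub HP; have nhH := disjointFr dSh HS.
have spec_H := atoms_flag_hypsP (subsetP sSG H HS).
case: H / spec_H HP nhH {HS} => [e|i _|H ->//] HP; first by rewrite rk_atom.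
by have := flag_nsub_hyp i hP; rewrite HP.
Qed.

(* The pairs [(S, K)] on which the contributions of the flag and of the
   hyperplane [K] to the degree map are both nonzero, and cancel. *)
Definition exceptional S K : bool :=
  [&& K \in hyps, S \subset [set [set e] | e : E], atoms_of S \subset K
    & M (atoms_of S) == #|atoms_of S|].

Lemma null_flag_rel_hyp S P : S \subset G -> [disjoint S & hyps] ->
  P \in hyps ->
  ~~ exceptional S P -> null (flag_rel S P).
Proof.
move=> sSG dSh hP nexc; rewrite flag_relE ?hyp_in ?hyp_rk_gt1 //; apply: nullZ.
have eq_box : mdeg flag_box = M P by rewrite mdeg_flag_box (rk_top_pred hP).
have [/existsP[i RiS]|no_flag] := boolP [exists i : 'I_l.+1, R i \in S].
  apply: (null_prod_flag_var RiS); rewrite mulrBl.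
  suff le_m : (mdeg flag_box <= mdeg (flag_rel_mnm S P))%N.
    by apply: nullB; apply: null_flag_var.
  have below_P H : H \in S -> H \proper P -> (1 < M H)%N -> H \subset set0.
    by move=> HS HP; rewrite ltnNge (hyp_below sSG dSh hP HS HP).
  rewrite mdeg_flag_rel_mnm eq_box; have := rk_union_below sSG below_P.
  have := subset_leq_card (subsetIl (atoms_of S) P).
  by rewrite rk0 setD0; clear; lia.
have sSa : S \subset [set [set e] | e : E].
  apply/subsetP => H HS; case/setUP: (subsetP sSG H HS) => [/setUP[//|]|hH].
    by case/imsetP => i _ eH; case/existsP: no_flag; exists i; rewrite -eH.
  by have := disjointFr dSh HS; rewrite hH.
apply/nullMl/null_mdeg; rewrite mdeg_flag_rel_mnm eq_box.
rewrite union_below_atoms ?hyp_rk_gt1 //.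
suff : (M (atoms_of S :&: P) < #|atoms_of S|)%N by clear; lia.
move: nexc; rewrite /exceptional hP sSa /=.
have [sAP /=|nsAP _] := boolP (atoms_of S \subset P).
  by rewrite (setIidPl sAP) ltn_neqAle rk_card andbT.
apply: leq_ltn_trans (rk_card _ _) (proper_card _).
by rewrite properE subsetIl subsetI subxx.
Qed.

Lemma null_flag_rel S K : S \subset G -> K \in G -> ~~ exceptional S K ->
  null (flag_rel S K).
Proof.
move=> sSG /atoms_flag_hypsP spec_K nexc.
have [dSh|/pred0Pn[P /andP[PS hP]]] := boolP [disjoint S & hyps]; last first.
  exact: null_flag_rel_hyp_mem PS hP.
case: K / spec_K nexc => [e|i le_i|P hP] nexc.
- exact: null_flag_rel_atom.
- exact: null_flag_rel_flag.
- exact: null_flag_rel_hyp.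
Qed.

Lemma exceptional_sub S K : exceptional S K -> S \subset G.
Proof.
case/and4P=> _ sSa _ _; apply: subset_trans sSa _.
by apply/subsetP => _ /imsetP[e _ ->]; apply: atom_in.
Qed.

Lemma exceptional_union_below S K :
  exceptional S K -> union_below S K = atoms_of S.
Proof.
by case/and4P=> hK sSa sAK _; rewrite union_below_atoms ?hyp_rk_gt1
  ?(setIidPl sAK).
Qed.

Lemma exceptional_disjoint S K : exceptional S K -> [disjoint S & hyps].
Proof.
case/and4P=> _ sSa _ _; apply/pred0P => P; apply/andP => -[/(subsetP sSa)].
by case/imsetP => e _ -> /card1_hyp; rewrite cards1.
Qed.

Lemma exceptional_dominated S P : exceptional S P ->
  dominated (flag_rel_mnm S P) flag_box.
Proof.
move=> exc; have [hP sSa sAP /eqP indA] := and4P exc.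
have leA : (#|atoms_of S| <= M P)%N by rewrite -indA rkS.
apply/dominatedP; rewrite mdeg_flag_rel_mnm exceptional_union_below // indA.
split=> [|i]; first by rewrite subnKC // mdeg_flag_box (rk_top_pred hP).
rewrite psum_flag_rel_mnm exceptional_union_below // indA psum_flag_box.
rewrite sub_flagE level_hyp //; have [le_i|lt_i] := leqP l i.
  by rewrite R_top // setIT mul1n subnKC // (rk_top_pred hP).
rewrite mul0n addn0 -ltnS (ltn_predK (flag_rk_gt1 i)).
rewrite -(sub_indep (subsetIl _ _) indA).
apply: leq_ltn_trans (rkS M (setSI _ sAP)) _.
apply: flat_rk_proper; first exact: flatI (flat_hyps hP) (flatR i).
by rewrite properE subsetIr subsetI subxx andbT flag_nsub_hyp.
Qed.

Lemma flag_rel_exceptional S P : exceptional S P ->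
  flag_rel S P = (-1) ^+ #|atoms_of S| *: 'X_[flag_rel_mnm S P].
Proof.
move=> exc; have [hP sSa sAP _] := and4P exc.
rewrite flag_relE ?(exceptional_sub exc) ?(exceptional_disjoint exc) ?hyp_in
  ?hyp_rk_gt1 //.
by rewrite big_pred0 ?mul1r // => i; apply/negbTE/sub_atoms_flag_notin.
Qed.

(* The flag and the other hyperplanes vanish, and the linear relations force the
   values of the atoms. *)
Definition hyp_sign P H : rat :=
  if H == P then 1 else - ((#|H| == 1%N) && (H \subset P))%:R.

Definition hyp_val P H : {poly rat} := hyp_sign P H *: 'X.

Local Notation hyp_rel P := (set_rel M G (hyp_val P)).

Lemma hyp_sign_atom P e : P \in hyps -> hyp_sign P [set e] = - (e \in P)%:R.
Proof.
move=> hP; rewrite /hyp_sign cards1 sub1set; case: eqP => // eP.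
by have := card1_hyp hP; rewrite -eP cards1.
Qed.

Lemma hyp_sign_flag P i : P \in hyps -> hyp_sign P (R i) = 0.
Proof.
move=> /(flag_nsub_hyp i) nsP; rewrite /hyp_sign card1_flag oppr0.
by case: eqP nsP => // ->; rewrite subxx.
Qed.

Lemma hyp_sign_hyp P K : K \in hyps -> hyp_sign P K = (K == P)%:R.
Proof. by move=> hK; rewrite /hyp_sign card1_hyp // oppr0; case: eqP. Qed.

Lemma hyp_sign_sub P H : hyp_sign P H != 0 -> H \subset P.
Proof.
rewrite /hyp_sign; have [->//|_] := eqVneq H P; case: (H \subset P) => //.
by rewrite andbF oppr0 eqxx.
Qed.

Lemma hyp_sign_sum P K : P \in hyps -> K \in G ->
  \sum_(H in G | K \subset H) hyp_sign P H = (K == P)%:R.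
Proof.
move=> hP KG; rewrite sum_above // [X in _ + X + _]big1 => [|i _]; last first.
  exact: hyp_sign_flag.
have -> : \sum_(H in hyps | K \subset H) hyp_sign P H = (K \subset P)%:R.
  rewrite (eq_bigr (fun H => (H == P)%:R)) => [|H /andP[]]; last first.
    by move=> hH _; apply: hyp_sign_hyp.
  case: (boolP (K \subset P)) => [sKP|nsKP].
    by rewrite (bigD1 P) /= ?hP // eqxx big1 ?addr0 // => H /andP[_ /negbTE->].
  by rewrite big1 // => H /andP[_ sKH]; case: eqP => // eH;
    rewrite -eH sKH in nsKP.
rewrite addr0; have spec_K := atoms_flag_hypsP KG.
case: K / spec_K {KG} => [e|i _|K hK].
- rewrite cards1 hyp_sign_atom // sub1set addNr; case: eqP => // eP.
  by have := card1_hyp hP; rewrite -eP cards1.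
- rewrite card1_flag (negbTE (flag_nsub_hyp i hP)) add0r; case: eqP => // eP.
  by have := flag_nsub_hyp i hP; rewrite -eP subxx.
by rewrite card1_hyp // hyp_sub // add0r.
Qed.

Lemma hyp_relE P S K : P \in hyps -> K \in G ->
  hyp_rel P S K = (\prod_(H in S) hyp_sign P H
    * (K == P)%:R ^+ (M K - M (union_below S K)))
  *: 'X^(#|S| + (M K - M (union_below S K))).
Proof.
move=> hP KG; rewrite /set_rel scaler_prod prodr_const -scaler_suml.
rewrite hyp_sign_sum //.
by rewrite exprZn -scalerAl -scalerAr scalerA exprD.
Qed.

Lemma leq_card_atoms_of S : (#|atoms_of S| <= #|S|)%N.
Proof.
rewrite -(card_imset _ set1_inj); apply/subset_leq_card/subsetP.
move=> _ /imsetP[e eS ->].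
by rewrite inE in eS.
Qed.

Lemma rk_union_below_hyp P S : P \in hyps -> S \subset G ->
  {in S, forall H, hyp_sign P H != 0} -> ~~ exceptional S P ->
  (M (union_below S P) < #|S|)%N.
Proof.
move=> hP sSG sign_S; apply: contraR; rewrite -leqNgt => le_S.
have le_A : (M (union_below S P) <= M (atoms_of S))%N.
  apply/rkS/bigcupsP => H /andP[HS prop]; have := sign_S H HS.
  rewrite /hyp_sign; have [eHP|_] := eqVneq H P;
    first by rewrite eHP properxx in prop.
  case: cards1P => [[e eH] _|]; last by rewrite oppr0 eqxx.
  by rewrite eH sub1set inE -eH.
have le_rk := rk_card M (atoms_of S); have le_card := leq_card_atoms_of S.
have eS : [set [set e] | e in atoms_of S] = S.
  apply/eqP; rewrite eqEcard (card_imset _ set1_inj).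
  rewrite (leq_trans le_S) ?(leq_trans le_A) // andbT.
  by apply/subsetP => _ /imsetP[e eS ->]; rewrite inE in eS.
rewrite /exceptional hP -{1}eS imsetS ?subset_predT //=; apply/andP; split.
  by apply/subsetP => e; rewrite inE => /sign_S/hyp_sign_sub; rewrite sub1set.
by rewrite eqn_leq le_rk; lia.
Qed.

Lemma rk_union_below_other P S K : P \in hyps -> S \subset G -> K \in G ->
  K != P ->
  {in S, forall H, hyp_sign P H != 0} -> (M (union_below S K) < M K)%N.
Proof.
move=> hP sSG KG neKP sign_S.
have [sKP|nsKP] := boolP (K \subset P).
  have spec_K := atoms_flag_hypsP KG.
  case: K / spec_K sKP neKP {KG} => [e|i _|K hK].
  - by move=> _ _; rewrite union_below_atom // rk0 rk_atom.
  - by rewrite (negbTE (flag_nsub_hyp i hP)).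
  - by rewrite hyp_sub // => ->.
have sub_KP : union_below S K \subset K :&: P.
  apply/bigcupsP => H /andP[HS /proper_sub sHK].
  by rewrite subsetI sHK (hyp_sign_sub (sign_S H HS)).
apply: leq_ltn_trans (rkS M sub_KP) _; apply: flat_rk_proper.
  exact: flatI (atoms_flag_hyps_flat KG) (flat_hyps hP).
by rewrite properE subsetIl subsetI subxx.
Qed.

Lemma null_hyp_rel P S K q : P \in hyps -> S \subset G -> K \in G ->
  ~~ ((K == P) && exceptional S K) -> (q * hyp_rel P S K)`_(M P) = 0.
Proof.
move=> hP sSG KG nexc; rewrite hyp_relE //; apply: coef_mulZXn.
have [/existsP[H /andP[HS /eqP sign0]]|] :=
    boolP [exists H, (H \in S) && (hyp_sign P H == 0)].
  by rewrite (bigD1 H) //= sign0 !mul0r eqxx.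
rewrite negb_exists => /forallP sign_n0.
have sign_S : {in S, forall H, hyp_sign P H != 0}.
  by move=> H HS; have := sign_n0 H; rewrite HS.
move: nexc; case: eqP => [->|/eqP neKP] /= => [nexc|_].
  have := rk_union_below_hyp hP sSG sign_S nexc.
  by move: #|S| => n lt_n; apply/orP; right; lia.
have := rk_union_below_other hP sSG KG neKP sign_S.
by rewrite expr0n subn_eq0 ltnNge => /negbTE->; rewrite mulr0 eqxx.
Qed.

Lemma hyp_rel_exceptional S P : exceptional S P ->
  hyp_rel P S P = (-1) ^+ #|atoms_of S| *: 'X^(M P).
Proof.
move=> exc; have [hP sSa sAP /eqP indA] := and4P exc.
have eS : S = [set [set e] | e in atoms_of S].
  apply/setP => H; apply/idP/imsetP => [HS|[e]]; last by rewrite inE => ? ->.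
  by have [e _ eH] := imsetP (subsetP sSa H HS); exists e; rewrite ?inE -?eH.
have cardS : #|S| = #|atoms_of S| by rewrite {1}eS (card_imset _ set1_inj).
have leA : (#|atoms_of S| <= M P)%N by rewrite -indA rkS.
rewrite hyp_relE ?hyp_in // eqxx expr1n mulr1 exceptional_union_below // indA.
rewrite cardS subnKC // -cardS -prodr_const.
congr (_ *: _); apply: eq_bigr => H; rewrite eS => /imsetP[e eA ->].
by rewrite hyp_sign_atom // (subsetP sAP).
Qed.

Local Notation Pol := {mpoly rat[#|G|]}.
Local Notation ideal := (@chow_ideal E M G).
Local Notation x := (xvar G).

Definition chow_deg (p : Pol) : rat :=
  residue flag_box (chow_eval flag_val p)
  - \sum_(P in hyps) (chow_eval (hyp_val P) p)`_(M P).

Fact chow_deg_is_linear : linear_for *%R chow_deg.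
Proof.
move=> c p q; rewrite /chow_deg !linearP /= mulrBr addrACA -opprD.
congr (_ - _); rewrite mulr_sumr -big_split; apply: eq_bigr => P _.
by rewrite linearP /= coefD coefZ.
Qed.

HB.instance Definition _ :=
  GRing.isLinear.Build rat Pol rat *%R chow_deg chow_deg_is_linear.

Lemma flag_val_mcoeff0 H : (flag_val H)@_0 = 0.
Proof.
have var0 i : (flag_var i)@_0 = 0.
  by rewrite /flag_var; case: ifP => _; rewrite ?mcoeff0 // mcoeffX mnm1_eq0.
rewrite /flag_val; do 2?case: ifP => _; rewrite ?mcoeffN ?mcoeffB ?mcoeff0 //.
  by rewrite var0 oppr0.
by rewrite !var0 subrr.
Qed.

Lemma chow_eval_flag_mcoeff0 (q : Pol) : (chow_eval flag_val q)@_0 = q@_0.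
Proof.
apply: (chow_eval_augmentation (eps := mcoeff 0)) => H _.
exact: flag_val_mcoeff0.
Qed.

Lemma chow_eval_hyp_coef0 P (q : Pol) : (chow_eval (hyp_val P) q)`_0 = q@_0.
Proof.
apply: (chow_eval_augmentation (eps := coefp 0)) => H _.
by rewrite /= coefZ coefX mulr0.
Qed.

Lemma chow_deg_rel (q : Pol) (S : {set 'I_#|G|}) g :
  chow_deg (q * chow_rel M S g) = 0.
Proof.
rewrite /chow_deg rmorphM /= chow_eval_rel.
under eq_bigr do rewrite rmorphM /= chow_eval_rel.
have : [set @enum_val _ (mem G) i | i in S] \subset G.
  by apply/subsetP => _ /imsetP[i _ ->]; apply: enum_valP.
have : @enum_val _ (mem G) g \in G by apply: enum_valP.
move: (enum_val g) [set _ | _ in S] => K {}S KG sSG.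
have [exc|nexc] := boolP (exceptional S K); last first.
  rewrite null_flag_rel // big1 ?subrr // => P hP.
  by rewrite null_hyp_rel // negb_and nexc orbT.
have hK : K \in hyps by case/and4P: exc.
rewrite flag_rel_exceptional // -scalerAr linearZ /=.
rewrite residue_dominated ?exceptional_dominated // (bigD1 K) //=.
rewrite big1 => [|P]; last first.
  by case/andP=> hP ne; rewrite null_hyp_rel // eq_sym negb_and ne.
rewrite hyp_rel_exceptional // -scalerAr coefZ coefMXn ltnn subnn addr0.
by rewrite chow_eval_flag_mcoeff0 chow_eval_hyp_coef0 subrr.
Qed.

Lemma chow_deg_ideal p : ideal p -> chow_deg p = 0.
Proof.
move=> [c ->]; rewrite linear_sum big1 // => S _;
  rewrite linear_sum big1 // => g _.
exact: chow_deg_rel.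
Qed.

Definition flag_gen i : Pol := \sum_(i <= j < l.+1) x (R j).

Definition flag_mon (m : 'X_{1..l.+1}) : Pol :=
  mmap1 (fun i : 'I_l.+1 => flag_gen i) m.

Lemma flag_monD m1 m2 : flag_mon (m1 + m2)%MM = flag_mon m1 * flag_mon m2.
Proof. by apply: commr_mmap1_M => i p; apply: mulrC. Qed.

Lemma flag_mon1 (i : 'I_l.+1) : flag_mon U_(i)%MM = flag_gen i.
Proof. exact: mmap1U. Qed.

Lemma flag_monX (i : 'I_l.+1) k : flag_mon (U_(i) *+ k)%MM = flag_gen i ^+ k.
Proof.
elim: k => [|k IHk]; first exact: mmap11.
by rewrite mulmS flag_monD flag_mon1 IHk exprS.
Qed.

Lemma flag_gen_recl i : (i <= l)%N -> x (R i) = flag_gen i - flag_gen i.+1.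
Proof. by move=> le_i; rewrite /flag_gen big_ltn // addrK. Qed.

Lemma sum_above_flag (V : nmodType) (F : {set E} -> V) i : (i <= l)%N ->
  \sum_(H in G | R i \subset H) F H = \sum_(i <= j < l.+1) F (R j).
Proof.
move=> le_i; rewrite sum_above ?flag_in // card1_flag level_flag // add0r.
rewrite [X in _ + X]big_pred0 ?addr0 // => P;
  apply/andP => -[/(flag_nsub_hyp i)].
by move/negbTE->.
Qed.

Lemma flag_gen0_ideal : ideal (flag_gen 0 ^+ M (R 0)).
Proof.
have := set_rel_ideal M (sub0set G) (flag_in (leq0n l)).
by rewrite /set_rel big_set0 mul1r sum_above_flag // union_below_set0 rk0 subn0.
Qed.

Lemma flag_genS_ideal i : (i < l)%N ->
  ideal ((flag_gen i - flag_gen i.+1)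
         * flag_gen i.+1 ^+ (M (R i.+1) - M (R i))).
Proof.
move=> lt_i; have RiG : [set R i] \subset G by rewrite sub1set flag_in // ltnW.
have := set_rel_ideal M RiG (flag_in lt_i).
rewrite /set_rel big_set1 sum_above_flag // union_below_set1 ?properR //.
by rewrite flag_gen_recl // ltnW.
Qed.

Lemma sum_above_top (V : nmodType) (F : {set E} -> V) :
  \sum_(H in G | setT \subset H) F H = F setT.
Proof. by rewrite -(R_top (leqnn l)) sum_above_flag // big_nat1. Qed.

Lemma hyp_top_ideal P : P \in hyps -> ideal (x P * x setT).
Proof.
move=> hP; have PG : [set P] \subset G by rewrite sub1set hyp_in.
have := set_rel_ideal M PG top_in; rewrite /set_rel big_set1 sum_above_top.
by rewrite union_below_set1 ?hyp_proper // -(rk_hyps hP) subSnn expr1.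
Qed.

Lemma hyp_incomparable_ideal P H : P \in hyps -> H \in G -> H \proper setT ->
  ~~ (H \subset P) -> ideal (x P * x H).
Proof.
move=> hP HG propH nsHP; have neHP : P != H by apply: contraNneq nsHP => ->.
have PHG : [set P; H] \subset G by rewrite subUset !sub1set hyp_in.
have := set_rel_ideal M PHG top_in.
rewrite /set_rel big_setU1 ?inE //= big_set1 sum_above_top.
have -> : union_below [set P; H] setT = P :|: H.
  by rewrite /union_below big_mkcondr big_setU1 ?inE //= big_set1 propH
    hyp_proper.
rewrite (_ : M setT - _ = 0)%N ?mulr1 //; apply/eqP;
  rewrite subn_eq0 -(rk_hyps hP).
apply: flat_rk_proper (flat_hyps hP) _.
by rewrite properE subsetUl subUset subxx.
Qed.

Lemma hyp_hyp_ideal P K : P \in hyps -> K \in hyps -> P != K ->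
  ideal (x P * x K).
Proof.
move=> hP hK nePK.
apply: hyp_incomparable_ideal; rewrite ?hyp_in ?hyp_proper //.
by rewrite hyp_sub // eq_sym.
Qed.

Lemma hyp_hyp_pow_ideal P K i j : P \in hyps -> K \in hyps -> P != K ->
  (0 < i)%N -> (0 < j)%N -> ideal (x P ^+ i * x K ^+ j).
Proof.
move=> hP hK nePK; case: i j => // i [//|j] _ _; rewrite !exprSr mulrACA.
exact/chow_idealM/hyp_hyp_ideal.
Qed.

Lemma hyp_flag_gen_ideal P i : P \in hyps -> ideal (x P * flag_gen i).
Proof.
move=> hP; rewrite mulr_sumr big_nat; apply: (big_ind ideal)
  => [||j /andP[_ le_j]].
- exact: chow_ideal0.
- exact: chow_idealD.
have [->|ne_j] := eqVneq j l; first by rewrite R_top //; apply: hyp_top_ideal.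
have lt_j : (j < l)%N by rewrite ltn_neqAle ne_j.
apply: hyp_incomparable_ideal; rewrite ?flag_in ?flag_nsub_hyp //.
by rewrite -(R_top (leqnn l)) (proper_sub_trans (properR lt_j)) ?flag_sub.
Qed.

Lemma hyp_pow_ideal P : P \in hyps -> ideal (x P ^+ M P + flag_gen l ^+ M P).
Proof.
move=> hP; have := set_rel_ideal M (sub0set G) (hyp_in hP).
rewrite /set_rel big_set0 mul1r sum_above ?hyp_in // card1_hyp // add0r.
rewrite level_hyp // -/(flag_gen l) (big_pred1 P) => [|K]; last first.
  by apply/andP/eqP => [[hK]|->]; [rewrite hyp_sub // => /eqP | rewrite hP].
rewrite union_below_set0 rk0 subn0 -(ltn_predK (hyp_rk_gt1 hP)).
have [c ->] := exprDn_mod (flag_gen l) (x P) (M P).-1.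
rewrite [flag_gen l * _]mulrC => Irel.
have := chow_idealB Irel (chow_idealM c (hyp_flag_gen_ideal l hP)).
by rewrite addrK addrC.
Qed.

Lemma atom_ideal e : ideal (x [set e]
  + (flag_gen (level [set e]) + \sum_(P in hyps | e \in P) x P)).
Proof.
have := set_rel_ideal M (sub0set G) (atom_in e).
rewrite /set_rel big_set0 mul1r sum_above ?atom_in // cards1.
rewrite union_below_set0 rk0 rk_atom expr1 -addrA.
by under [X in _ + (_ + X)]eq_bigl do rewrite sub1set.
Qed.

Lemma flag_mon_straighten (m : 'X_{1..l.+1}) :
  ideal (flag_mon m) \/
  exists m', [/\ (m' <= flag_box)%MM, mdeg m' = mdeg m
    & ideal (flag_mon m - flag_mon m')].
Proof.
have [n] := ubnP (mnmwgt m); elim: n m => // n IHn m lt_m.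
have [le_m|] := boolP (m <= flag_box)%MM.
  by right; exists m; split; rewrite // subrr; apply: chow_ideal0.
rewrite negb_forall => /existsP[[[|i] lt_i]]; rewrite -ltnNge mnmE /= => lt_mi.
  left; have le_m : (U_(Ordinal lt_i) *+ M (R 0) <= m)%MM.
    apply/mnm_lepP => j; rewrite mulmnE mnm1E; case: eqP => // <-.
    by rewrite mul1n -(ltn_predK rkR0).
  by rewrite -(submK le_m) flag_monD flag_monX;
    apply/chow_idealM/flag_gen0_ideal.
set k := (M (R i.+1) - M (R i))%N in lt_mi; pose o := Ordinal lt_i.
pose o' := Ordinal (ltnW lt_i).
have le_m : (U_(o) *+ k.+1 <= m)%MM.
  by apply/mnm_lepP => j; rewrite mulmnE mnm1E; case: eqP => // <-;
    rewrite mul1n.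
pose m' := (m - U_(o) *+ k.+1 + (U_(o') + U_(o) *+ k))%MM.
have eq_m : m = (m - U_(o) *+ k.+1 + (U_(o) + U_(o) *+ k))%MM
  by rewrite -mulmS submK.
have wgt_m' : (mnmwgt m' < n)%N.
  rewrite ltnS in lt_m; apply: leq_trans lt_m;
    rewrite eq_m /m' !mnmwgtD !mnmwgt1 /=.
  by clear; lia.
have deg_m' : mdeg m' = mdeg m by rewrite eq_m /m' !mdegD !mdeg1.
have Imm' : ideal (flag_mon m' - flag_mon m).
  rewrite eq_m /m' !flag_monD !flag_mon1 flag_monX -mulrBr -mulrBl.
  exact/chow_idealM/flag_genS_ideal.
case: (IHn m' wgt_m') => [Im'|[m'' [le_m'' deg_m'' Im'']]]; [left|right].
  by have := chow_idealB Im' Imm'; rewrite subKr.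
exists m''; split; rewrite ?deg_m'' //.
by have := chow_idealB Im'' Imm'; rewrite opprB addrC addrA subrK.
Qed.

Local Notation idx := ('X_{1..l.+1 < M setT} + {set E})%type.

Definition in_degree (d : nat) (t : idx) : bool :=
  match t with
  | inl m => (mdeg m == d) && (m <= flag_box)%MM
  | inr P => (P \in hyps) && (0 < d < (M setT).-1)%N
  end.

Definition chow_index (d : nat) : {set idx} := [set t | in_degree d t].

Definition chow_monomial (d : nat) (t : idx) : Pol :=
  match t with inl m => flag_mon m | inr P => x P ^+ d end.

Definition spanned (d : nat) : Pol -> Prop :=
  chow_spanned M (chow_index d) (chow_monomial d).

Lemma hyp_flag_mon_ideal P k m : P \in hyps -> (0 < k)%N -> m != 0%MM ->
  ideal (x P ^+ k * flag_mon m).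
Proof.
move=> hP k_gt0 /mnm_neq0[i [m' ->]]; rewrite -(prednK k_gt0) exprSr.
rewrite flag_monD flag_mon1 mulrACA.
exact/chow_idealM/hyp_flag_gen_ideal.
Qed.

Lemma spanned_flag_mon m : spanned (mdeg m) (flag_mon m).
Proof.
case: (flag_mon_straighten m) => [Im|[m' [le_m' <- Im]]].
  exact: chow_spanned_ideal.
apply: chow_spanned_congr Im _.
have lt_m' : (mdeg m' < M setT)%N.
  rewrite -(ltn_predK rkT) -mdeg_flag_box ltnS -(submK le_m') mdegD.
  exact: leq_addl.
apply: (@chow_spanned_mem _ _ _ _ _ _ (inl (BMultinom lt_m'))).
by rewrite inE /= eqxx.
Qed.

Lemma spanned_hyp P d : P \in hyps -> spanned d.+1 (x P ^+ d.+1).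
Proof.
move=> hP; have rkP := rk_top_pred hP.
have [lt_d|] := ltnP d.+1 (M P).
  apply: (@chow_spanned_mem _ _ _ _ _ _ (inr P)).
  by rewrite inE /= hP rkP.
rewrite leq_eqVlt => /predU1P[<-|lt_d].
  have := chow_spannedN (spanned_flag_mon (U_(ord_max) *+ M P)).
  rewrite mdegMn mdeg1 mul1n flag_monX; apply: chow_spanned_congr.
  by rewrite opprK; apply: hyp_pow_ideal.
apply: chow_spanned_ideal; rewrite -(subnK lt_d) exprD; apply: chow_idealM.
rewrite exprS -[x P ^+ M P](addrK (flag_gen l ^+ M P)) mulrBr.
apply: chow_idealB; first exact/chow_idealM/hyp_pow_ideal.
rewrite -(ltn_predK (hyp_rk_gt1 hP)) exprS mulrA mulrC.
exact/chow_idealM/hyp_flag_gen_ideal.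
Qed.

Definition raises_degree (y : Pol) : Prop :=
  forall d p, spanned d p -> spanned d.+1 (y * p).

Lemma raises_degree0 : raises_degree 0.
Proof.
by move=> d p _; rewrite mul0r; apply/chow_spanned_ideal/chow_ideal0.
Qed.

Lemma raises_degreeD y z : raises_degree y -> raises_degree z ->
  raises_degree (y + z).
Proof.
move=> hy hz d p hp; rewrite mulrDl.
by apply: chow_spannedD; [exact: hy | exact: hz].
Qed.

Lemma raises_degreeN y : raises_degree y -> raises_degree (- y).
Proof. by move=> hy d p hp; rewrite mulNr; apply/chow_spannedN/hy. Qed.

Lemma raises_degree_congr y z :
  ideal (y - z) -> raises_degree z -> raises_degree y.
Proof.
move=> Iyz hz d p hp; apply: chow_spanned_congr (hz d p hp).
by rewrite -mulrBl mulrC; apply: chow_idealM.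
Qed.

Lemma raises_degree_monomials y :
  (forall m, spanned (mdeg m).+1 (y * flag_mon m)) ->
  (forall P d, P \in hyps -> spanned d.+2 (y * x P ^+ d.+1)) -> raises_degree y.
Proof.
move=> sp_mon sp_hyp d p [c Ip].
apply: (@chow_spanned_congr _ _ _ _ _ _ _
  (y * \sum_(t in chow_index d) c t *: chow_monomial d t)).
  by rewrite -mulrBr; apply: chow_idealM.
rewrite mulr_sumr; apply: chow_spanned_sum => -[m|P]; rewrite inE /= -scalerAr.
  by case/andP=> /eqP <- _; apply/chow_spannedZ/sp_mon.
by case: d {Ip} => [|d] /andP[hP] // _; apply/chow_spannedZ/sp_hyp.
Qed.

Lemma raises_degree_flag_gen (i : 'I_l.+1) : raises_degree (flag_gen i).
Proof.
apply: raises_degree_monomials => [m|P d hP].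
  have := spanned_flag_mon (U_(i) + m)%MM.
  by rewrite mdegD mdeg1 flag_monD flag_mon1.
apply: chow_spanned_ideal; rewrite exprS mulrA mulrC [flag_gen i * _]mulrC.
exact/chow_idealM/hyp_flag_gen_ideal.
Qed.

Lemma raises_degree_flag i : (i <= l)%N -> raises_degree (x (R i)).
Proof.
move=> le_i; rewrite flag_gen_recl //; apply: raises_degreeD.
  exact: (raises_degree_flag_gen (@Ordinal l.+1 i le_i)).
apply: raises_degreeN; have [lt_i|ge_i] := ltnP i l.
  exact: (raises_degree_flag_gen (@Ordinal l.+1 i.+1 lt_i)).
by rewrite /flag_gen big_geq //; apply: raises_degree0.
Qed.

Lemma raises_degree_hyp P : P \in hyps -> raises_degree (x P).
Proof.
move=> hP; apply: raises_degree_monomials => [m|K d hK].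
  have [->|m_neq0] := eqVneq m 0%MM.
    rewrite mdeg0 /flag_mon mmap11 mulr1 -[x P]expr1; exact: spanned_hyp.
  apply: chow_spanned_ideal; rewrite -[x P]expr1.
  exact: hyp_flag_mon_ideal.
have [->|nePK] := eqVneq P K; first by rewrite -exprS; apply: spanned_hyp.
apply: chow_spanned_ideal; rewrite exprSr mulrCA.
exact/chow_idealM/hyp_hyp_ideal.
Qed.

Lemma raises_degree_xvar H : H \in G -> raises_degree (x H).
Proof.
case/atoms_flag_hypsP => [e|i|P];
  [|exact: raises_degree_flag|exact: raises_degree_hyp].
have Ie := atom_ideal e; rewrite -[X in _ + X]opprK in Ie.
apply: raises_degree_congr Ie _; apply/raises_degreeN/raises_degreeD.
  exact: (raises_degree_flag_gen (@Ordinal l.+1 _ (level_max [set e]))).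
apply: (big_ind raises_degree) => [||P /andP[hP _]].
- exact: raises_degree0.
- exact: raises_degreeD.
- exact: raises_degree_hyp.
Qed.

Lemma spanned_monomial m : spanned (mdeg m) 'X_[m].
Proof.
have [n] := ubnP (mdeg m); elim: n m => // n IHn m.
have [->|/mnm_neq0[i [m' ->]]] := eqVneq m 0%MM.
  rewrite mdeg0 mpolyX0 -[1](mmap11 (fun i : 'I_l.+1 => flag_gen i)) => _.
  by have := spanned_flag_mon 0%MM; rewrite mdeg0.
rewrite mdegD mdeg1 addn1 ltnS => lt_m'.
rewrite addmC mpolyXD -xvar_elt.
by apply: raises_degree_xvar (enum_valP i) _ _ _; apply: IHn.
Qed.

Lemma spanned_homog d (p : Pol) : p \is d.-homog -> spanned d p.
Proof.
move/dhomogP => hp; rewrite [p]mpolyE big_seq; apply: chow_spanned_sum.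
move=> m /hp <-.
exact/chow_spannedZ/spanned_monomial.
Qed.

Lemma flag_mon_homog m : flag_mon m \is (mdeg m).-homog.
Proof.
have [n] := ubnP (mdeg m); elim: n m => // n IHn m.
have [->|/mnm_neq0[i [m' ->]]] := eqVneq m 0%MM.
  by rewrite mdeg0 /flag_mon mmap11 dhomog1.
rewrite mdegD mdeg1 flag_monD flag_mon1 => lt_m'.
apply: dhomogM; first by apply: IHn; rewrite addn1 ltnS in lt_m'.
rewrite /flag_gen big_nat rpred_sum // => j /andP[_ lt_j].
exact/xvar_homog/flag_in.
Qed.

Lemma chow_monomial_homog d t :
  t \in chow_index d -> chow_monomial d t \is d.-homog.
Proof.
rewrite inE; case: t => [m|P] /= => [/andP[/eqP <- _]|/andP[hP _]].
  exact: flag_mon_homog.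
by have := dhomogMn d (xvar_homog (hyp_in hP)); rewrite mul1n.
Qed.

Lemma chow_eval_flag_mon m : chow_eval flag_val (flag_mon m) = 'X_[m].
Proof.
rewrite /flag_mon /mmap1 rmorph_prod mpolyXE_id; apply: eq_bigr => i _.
rewrite rmorphXn /= rmorph_sum /=; congr (_ ^+ _).
have le_i : (i <= l)%N by rewrite -ltnS.
rewrite big_nat; under eq_bigr => j /andP[_ lt_j] do
  rewrite chow_eval_xvar ?flag_in // flag_val_flag //.
by rewrite -big_nat telescope_flag_var // /flag_var le_i inord_val.
Qed.

Lemma chow_eval_hyp_mon P m : P \in hyps ->
  chow_eval (hyp_val P) (flag_mon m) = (m == 0%MM)%:R.
Proof.
move=> hP; rewrite -mmap1_0 /flag_mon /mmap1 rmorph_prod; apply: eq_bigr => i _.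
rewrite rmorphXn /= rmorph_sum /= big_nat big1 // => j /andP[_ lt_j].
by rewrite chow_eval_xvar ?flag_in // /hyp_val hyp_sign_flag // scale0r.
Qed.

Lemma chow_deg_flag_mon m : chow_deg (flag_mon m) = (dominated m flag_box)%:R.
Proof.
rewrite /chow_deg chow_eval_flag_mon residueX big1 ?subr0 // => P hP.
rewrite chow_eval_hyp_mon // -polyC_natr coefC.
by rewrite gtn_eqF // ltnW // hyp_rk_gt1.
Qed.

Lemma chow_deg_hyp_pow P : P \in hyps -> chow_deg (x P ^+ M P) = -1.
Proof.
move=> hP; have rkP_gt0 : (0 < M P)%N := ltnW (hyp_rk_gt1 hP).
have evP (A : comAlgType rat) (F : {set E} -> A) :
    chow_eval F (x P ^+ M P) = F P ^+ M P.
  by rewrite rmorphXn /= chow_eval_xvar ?hyp_in.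
rewrite /chow_deg evP flag_val_hyp // expr0n gtn_eqF // linear0 sub0r;
  congr (- _).
rewrite (bigD1 P) //= big1 => [|K /andP[hK neKP]];
  rewrite evP /hyp_val hyp_sign_hyp //.
  by rewrite eqxx scale1r coefXn eqxx addr0.
by rewrite eq_sym (negbTE neKP) scale0r expr0n gtn_eqF // coef0.
Qed.

Definition chow_dual (d : nat) (t : idx) : Pol :=
  match t with
  | inl m => flag_mon (flag_box - m)%MM
  | inr P => x P ^+ (M P - d)
  end.

Definition chow_weight (t : idx) : nat :=
  if t is inl m then \sum_(j < l.+1) psum m j else 0.

Lemma chow_pairing_diag d t : t \in chow_index d ->
  chow_deg (chow_dual d t * chow_monomial d t) != 0.
Proof.
rewrite inE; case: t => [m|P] /= => [/andP[_ le_m]|/and3P[hP _ lt_d]].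
  by rewrite -flag_monD submK // chow_deg_flag_mon dominated_refl oner_neq0.
rewrite -exprD subnK; first by rewrite chow_deg_hyp_pow // oppr_eq0 oner_neq0.
by rewrite ltnW // -(rk_top_pred hP).
Qed.

Lemma chow_pairing_tri d t u : t \in chow_index d -> u \in chow_index d ->
  u != t ->
  chow_deg (chow_dual d t * chow_monomial d u) != 0 ->
  (chow_weight u < chow_weight t)%N.
Proof.
have deg0 p : ideal p -> (chow_deg p != 0) = false.
  by move/chow_deg_ideal->; rewrite eqxx.
rewrite !inE; case: t u => [m|P] [m'|K] /=.
- move=> /andP[_ le_m] _ ne_m; rewrite -flag_monD chow_deg_flag_mon.
  rewrite -{2}(submK le_m) dominatedDl.
  by case: (boolP (dominated _ _)) => // dom _; apply: dominated_ltn_sum_psum.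
- move=> /andP[/eqP deg_m le_m] /and3P[hK d_gt0 lt_d] _; rewrite deg0 // mulrC.
  apply: hyp_flag_mon_ideal => //; apply: contraTneq lt_d => eq_m.
  by rewrite -mdeg_flag_box -(submK le_m) eq_m mdegD mdeg0 deg_m ltnn.
- move=> /and3P[hP d_gt0 lt_d] /andP[/eqP deg_m _] _; rewrite deg0 //.
  apply: hyp_flag_mon_ideal; rewrite // ?subn_gt0 -?(rk_top_pred hP) //.
  by rewrite -mdeg_eq0 deg_m -lt0n.
move=> /and3P[hP d_gt0 lt_d] /andP[hK _] neKP; rewrite deg0 //.
by apply: hyp_hyp_pow_ideal; rewrite // 1?eq_sym // subn_gt0 -(rk_top_pred hP).
Qed.

Lemma chow_dim_flag d : chow_dim M G d #|chow_index d|.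
Proof.
apply: chow_dim_basis (@chow_monomial_homog d) (@spanned_homog d) _.
apply: chow_free_pairing chow_deg_ideal _ _.
  exact: chow_pairing_diag.
exact: chow_pairing_tri.
Qed.

Lemma card_chow_index d : (0 < d < (M setT).-1)%N -> (d < M (R 0))%N ->
  (forall i, (i < l)%N -> (M (R i) + d <= M (R i.+1))%N) ->
  #|chow_index d| = ('C(d + l, d) + #|hyps|)%N.
Proof.
move=> d_rng lt_d0 le_dS; have /andP[_ lt_d] := d_rng.
rewrite -(@card_mdeg l (M setT)) ?(leq_trans lt_d) ?leq_pred // -!sum1_card.
rewrite (eq_bigl (in_degree d)) => [|t]; last by rewrite inE.
rewrite big_sumType /=; congr (_ + _)%N; apply: eq_bigl; last first.
  by move=> P; rewrite d_rng andbT.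
move=> m; rewrite inE; apply/andb_idr => /eqP deg_m; apply/mnm_lepP => j.
apply: leq_trans (leq_mnm_mdeg m j) _; rewrite deg_m mnmE /=.
case: j => -[|i] lt_i /=; first by rewrite -ltnS (ltn_predK lt_d0).
by rewrite leq_subRL ?le_dS // (leq_trans (leq_addr d _)) ?le_dS.
Qed.

Definition flag_hilbert : {poly nat} := \poly_(d < M setT) #|chow_index d|.

Lemma nth_flag_hilbert d : nth 0%N flag_hilbert d = #|chow_index d|.
Proof.
rewrite -[LHS]/(flag_hilbert`_d) coef_poly; case: ltnP => // le_d;
  apply/esym/eqP.
rewrite cards_eq0; apply/eqP/setP => -[m|P]; rewrite !inE /=.
  apply/negP => /andP[/eqP deg_m _]; have := bmdeg m.
  by rewrite deg_m ltnNge le_d.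
by apply/negP => /and3P[_ _]; rewrite ltnNge (leq_trans (leq_pred _)).
Qed.

Lemma chow_hilbert_flag : chow_hilbert M G flag_hilbert.
Proof. by move=> d; rewrite nth_flag_hilbert; apply: chow_dim_flag. Qed.

End FlagAndHyperplanes.

Lemma flag_hilbert_not_log_concave (E : finType) (M : matroid E)
    (R : nat -> {set E}) (hyps : {set {set E}}) :
  3 < M (R 0) -> M (R 0) + 3 <= M (R 1) -> M (R 1) + 3 <= M (R 2) ->
  R 2 = setT -> 6 < #|hyps| -> ~ log_concave (flag_hilbert M 2 R hyps).
Proof.
move=> rkR0 rkR1 rkR2 R2 hyps_gt6 lc.
have rkT : M (R 2) = M setT by rewrite R2.
have dim d : 0 < d < 4 ->
    nth 0 (flag_hilbert M 2 R hyps) d = 'C(d + 2, d) + #|hyps|.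
  move=> /andP[d_gt0 d_lt4]; rewrite nth_flag_hilbert card_chow_index //;
    try lia.
  by case=> [|[|//]] _; lia.
have dim1 : nth 0 (flag_hilbert M 2 R hyps) 1 = #|hyps| + 3
  by rewrite dim // addnC.
have dim2 : nth 0 (flag_hilbert M 2 R hyps) 2 = #|hyps| + 6
  by rewrite dim // addnC.
have dim3 : nth 0 (flag_hilbert M 2 R hyps) 3 = #|hyps| + 10
  by rewrite dim // addnC.
have size_gt3 : 3 < size (flag_hilbert M 2 R hyps).
  by rewrite ltnNge; apply/negP => /(nth_default 0); rewrite dim3 addnS.
have := lc 2 isT; rewrite dim1 dim2 dim3 -ltnS (ltn_predK size_gt3).
move=> /(_ size_gt3).
by move: hyps_gt6; clear; nia.
Qed.

(** * Separators and products of lattices of flats *)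

Lemma bot_top_trivial d (L : latticeType d) (b : L) :
  (forall z, b <= z)%O -> (forall z, z <= b)%O -> ~ nontrivial_type L.
Proof.
move=> b_min b_max [y [z]]; apply.
have eq_b w : w = b by apply: le_anti; rewrite b_max b_min.
by rewrite (eq_b y) (eq_b z).
Qed.

Section FlatsLattice.

Variables (E : finType) (M : matroid E) (F : {set E}) (fF : flat M F).

(* The proof argument keys the lattice structure: joins stay below [F] only
   because [F] is a flat. *)
Definition flats_below of flat M F : Type := {H : {set E} | below M F H}.
Local Notation L := (flats_below fF).

HB.instance Definition _ := Choice.on L.

Definition le_flats : rel L := fun x y => sval x \subset sval y.

Fact le_flats_refl : reflexive le_flats.
Proof. by move=> x; apply: subxx. Qed.

Fact le_flats_anti : antisymmetric le_flats.
Proof. by move=> x y le_xy; apply/val_inj/eqP; rewrite eqEsubset. Qed.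

Fact le_flats_trans : transitive le_flats.
Proof. by move=> x y z; apply: subset_trans. Qed.

Fact flats_display : Order.disp_t. Proof. exact: Order.Disp tt tt. Qed.

HB.instance Definition _ := Order.Le_isPOrder.Build flats_display L
  le_flats_refl le_flats_anti le_flats_trans.

Fact meet_flats_subproof (x y : L) : below M F (sval x :&: sval y).
Proof.
case: x y => H /= /andP[fH sH] [K /= /andP[fK _]].
by rewrite /below flatI // subIset ?sH.
Qed.

Fact join_flats_subproof (x y : L) : below M F (span M (sval x :|: sval y)).
Proof.
case: x y => H /= /andP[fH sH] [K /= /andP[fK sK]].
by rewrite /below flat_span span_min // subUset sH.
Qed.

Definition meet_flats (x y : L) : L :=
  exist (fun H => below M F H) _ (meet_flats_subproof x y).
Definition join_flats (x y : L) : L :=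
  exist (fun H => below M F H) _ (join_flats_subproof x y).

Fact meet_flatsP (x y z : L) :
  (x <= meet_flats y z)%O = (x <= y)%O && (x <= z)%O.
Proof. exact: subsetI. Qed.

Fact join_flatsP (x y z : L) :
  (join_flats x y <= z)%O = (x <= z)%O && (y <= z)%O.
Proof.
rewrite /Order.le /= /le_flats /= -subUset; apply/idP/idP.
  exact/subset_trans/sub_span.
by apply: span_min; have /andP[] := svalP z.
Qed.

HB.instance Definition _ :=
  Order.POrder_MeetJoin_isLattice.Build flats_display L
  meet_flatsP join_flatsP.

End FlatsLattice.

Section Separators.

Variables (E : finType) (M : matroid E) (F : {set E}).
Hypotheses (simpleM : simple_matroid M) (fF : flat M F).
Implicit Types (A B H K X : {set E}) (e : E).

(* The reverse inequality is submodularity. *)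
Definition separates A : bool :=
  [&& A \subset F, A != set0, A != F & M A + M (F :\: A) <= M F].

Lemma separates_setD A : separates A -> separates (F :\: A).
Proof.
case/and4P=> sAF nA0 nAF sepA; have eqA : F :\: (F :\: A) = A.
  by rewrite setDDr setDv set0U (setIidPr sAF).
rewrite /separates subsetDl eqA addnC sepA andbT /=; apply/andP; split.
  by apply: contra_neq nAF => eq0; rewrite -eqA eq0 setD0.
by apply: contra_neq nA0 => eqF; rewrite -eqA eqF setDv.
Qed.

Section SeparatorDecomposes.

Variable A : {set E}.
Hypothesis sepA : separates A.

Let sAF : A \subset F. Proof. by case/and4P: sepA. Qed.

Lemma separates_setUI H K : H \subset A -> K \subset F :\: A ->
  (H :|: K) :&: A = H /\ (H :|: K) :&: (F :\: A) = K.
Proof.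
move=> sHA; rewrite subsetD -setI_eq0 => /andP[sKF /eqP dKA].
rewrite !setIUl !setIDA dKA (setIidPl sHA) (setIidPl sKF) setU0; split=> //.
rewrite (setIidPl (subset_trans sHA sAF)) (_ : H :\: A = set0) ?set0U.
  by apply/setDidPl; rewrite -setI_eq0 dKA.
by apply/eqP; rewrite setD_eq0.
Qed.

Lemma separates_rkU H K : H \subset A -> K \subset F :\: A ->
  M H + M K <= M (H :|: K).
Proof.
move=> sHA sKB; have [_ _ _ le_rk] := and4P sepA.
have := rk_submod M (H :|: K) A; have := rk_submod M (A :|: K) (F :\: A).
have [-> _] := separates_setUI sHA sKB.
have [_ ->] := separates_setUI (subxx A) sKB.
rewrite [H :|: K :|: A]setUAC (setUidPr sHA) -setUA (setUidPr sKB) setUD_sub //.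
by move: le_rk; clear; lia.
Qed.

Lemma separates_flatU H K : flat M H -> flat M K -> H \subset A ->
  K \subset F :\: A -> flat M (H :|: K).
Proof.
move=> fH fK sHA sKB; have sKF := subset_trans sKB (subsetDl F A).
have sUF : H :|: K \subset F by rewrite subUset (subset_trans sHA) ?sKF.
have le_rkU : M (H :|: K) <= M H + M K.
  by apply: leq_trans (rk_submod M H K); apply: leq_addr.
apply/forallP => e; apply/implyP; rewrite inE negb_or => /andP[neH neK].
have [eF|neF] := boolP (e \in F); last exact: flat_rk_setU1 fF sUF neF.
apply: leq_ltn_trans le_rkU _.
have [eA|neA] := boolP (e \in A).
  rewrite setUA; apply: leq_trans (separates_rkU _ sKB);
    last by rewrite subUset sub1set eA.
  by rewrite -addSn leq_add2r (flat_rk_setU1 fH).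
rewrite setUCA; apply: leq_trans (separates_rkU sHA _).
  by rewrite -addnS leq_add2l (flat_rk_setU1 fK).
by rewrite subUset sub1set sKB inE neA eF.
Qed.

Lemma separates_flat : flat M A.
Proof.
apply/forallP => e; apply/implyP => neA.
have [eF|neF] := boolP (e \in F); last exact: flat_rk_setU1 fF sAF neF.
rewrite setUC; apply: leq_trans (separates_rkU (subxx A) _).
  by rewrite simple_rk_set1 // addn1.
by rewrite sub1set inE neA eF.
Qed.

End SeparatorDecomposes.

Lemma separates_decomposable A : separates A -> lattice_decomposable M F.
Proof.
move=> sepA; have [sAF nA0 nAF _] := and4P sepA.
have fA := separates_flat sepA; have sepB := separates_setD sepA.
have fB := separates_flat sepB; have fl0 : flat M set0 by case: simpleM.
have restr B (fB' : flat M B) (K : interval M F) : below M B (val K :&: B).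
  by have /andP[fK _] := valP K; rewrite /below flatI ?subsetIr.
pose f (K : interval M F) : flats_below fA * flats_below fB :=
  (exist (fun H => below M A H) _ (restr A fA K),
   exist (fun H => below M (F :\: A) H) _ (restr _ fB K)).
have join (u : flats_below fA * flats_below fB) :
    below M F (val u.1 :|: val u.2).
  have [/andP[f1 s1] /andP[f2 s2]] := (valP u.1, valP u.2).
  rewrite /below (separates_flatU sepA) // subUset (subset_trans s1) //.
  by rewrite (subset_trans s2) ?subsetDl.
have nontrivial B (fB' : flat M B) :
    B != set0 -> nontrivial_type (flats_below fB').
  move=> nB0; have below0 : below M B set0 by rewrite /below fl0 sub0set.
  have belowB : below M B B by rewrite /below fB' subxx.
  exists (exist (fun H => below M B H) _ below0),
    (exist (fun H => below M B H) _ belowB).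
  by move=> /(congr1 val) /= eB; rewrite -eB eqxx in nB0.
exists flats_display, flats_display, (flats_below fA), (flats_below fB), f.
split; try exact: nontrivial; first by apply: nontrivial; case/and4P: sepB.
have partF K : K \subset F -> K :&: A :|: K :&: (F :\: A) = K.
  by move=> sKF; rewrite setIDA (setIidPl sKF) setID.
split=> [|H K].
  exists (fun u => exist (fun H => below M F H) _ (join u)) => [K|[H K]].
    by apply: val_inj; rewrite /= partF //; case/andP: (valP K).
  have [/andP[_ sHA] /andP[_ sKB]] := (valP H, valP K).
  by congr pair; apply: val_inj; case: (separates_setUI sepA sHA sKB).
apply/andP/idP => [[le1 le2]|sHK]; last by split; apply: setSI.
have [/andP[_ sHF] /andP[_ sKF]] := (valP H, valP K).
by rewrite /le_interval -(partF _ sHF) -(partF _ sKF) setUSS.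
Qed.

Section LatticeSplitting.

Variables (d1 d2 : Order.disp_t) (L1 : latticeType d1) (L2 : latticeType d2).
Variables (f : interval M F -> L1 * L2) (g : L1 * L2 -> interval M F).
Hypotheses (fK : cancel f g) (gK : cancel g f).
Hypothesis le_f : forall H K : interval M F,
  ((f H).1 <= (f K).1)%O && ((f H).2 <= (f K).2)%O = le_interval H K.

Let fl0 : flat M set0. Proof. by case: simpleM. Qed.

Let bot : interval M F :=
  exist (fun H => below M F H) set0 (introT andP (conj fl0 (sub0set F))).

Let top : interval M F :=
  exist (fun H => below M F H) F (introT andP (conj fF (subxx F))).

Definition flat_at (x : L1) (y : L2) : {set E} := val (g (x, y)).

Lemma flat_at_flat x y : flat M (flat_at x y).
Proof. by case/andP: (valP (g (x, y))). Qed.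

Lemma flat_at_subF x y : flat_at x y \subset F.
Proof. by case/andP: (valP (g (x, y))). Qed.

Lemma sub_flat_at x y x' y' :
  (flat_at x y \subset flat_at x' y') = (x <= x')%O && (y <= y')%O.
Proof. by rewrite -[LHS]/(le_interval _ _) -le_f !gK. Qed.

Lemma flat_atP K : flat M K -> K \subset F -> exists x y, K = flat_at x y.
Proof.
move=> fl_K sKF; have bK : below M F K by rewrite /below fl_K.
pose K' : interval M F := exist _ K bK; exists (f K').1, (f K').2.
by rewrite /flat_at -surjective_pairing fK.
Qed.

Lemma flat_at_bot : flat_at (f bot).1 (f bot).2 = set0.
Proof. by rewrite /flat_at -surjective_pairing fK. Qed.

Lemma flat_at_top : flat_at (f top).1 (f top).2 = F.
Proof. by rewrite /flat_at -surjective_pairing fK. Qed.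

Lemma bot_le x y : ((f bot).1 <= x)%O /\ ((f bot).2 <= y)%O.
Proof. by apply/andP; rewrite -sub_flat_at flat_at_bot sub0set. Qed.

Lemma le_top x y : (x <= (f top).1)%O /\ (y <= (f top).2)%O.
Proof. by apply/andP; rewrite -sub_flat_at flat_at_top flat_at_subF. Qed.

Lemma flat_atU x y : flat_at x y = flat_at x (f bot).2 :|: flat_at (f bot).1 y.
Proof.
have [b1x b2y] := bot_le x y; apply/eqP; rewrite eqEsubset subUset !sub_flat_at.
rewrite !lexx b1x b2y !andbT; apply/subsetP => e exy.
have [|x' [y' eq_e]] := flat_atP (proj2 simpleM e).
  by rewrite sub1set (subsetP (flat_at_subF x y)).
have /andP[le_x le_y] : (x' <= x)%O && (y' <= y)%O.
  by rewrite -sub_flat_at -eq_e sub1set.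
have : flat_at x' (f bot).2 \subset [set e].
  by rewrite eq_e sub_flat_at lexx; case: (bot_le x' y').
rewrite subset1 inE -!sub1set eq_e => /orP[/eqP<-|/eqP x'0].
  by rewrite sub_flat_at le_x lexx.
have /andP[x'b _] : (x' <= (f bot).1)%O && ((f bot).2 <= (f bot).2)%O.
  by rewrite -sub_flat_at x'0 sub0set.
by rewrite [X in _ || X]sub_flat_at x'b le_y orbT.
Qed.

Lemma flat_atI x y : flat_at x (f bot).2 :&: flat_at (f bot).1 y = set0.
Proof.
apply/eqP; rewrite -subset0; apply/subsetP => e /setIP[ex ey].
have [|x' [y' eq_e]] := flat_atP (proj2 simpleM e).
  by rewrite sub1set (subsetP (flat_at_subF x (f bot).2)).
move: ex ey; rewrite -!sub1set -flat_at_bot eq_e !sub_flat_at.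
by move=> /andP[_ ->] /andP[->].
Qed.

Lemma flat_at_eq0 x y : flat_at x y = set0 -> x = (f bot).1 /\ y = (f bot).2.
Proof.
by rewrite -flat_at_bot => /val_inj/(can_inj gK)[-> ->].
Qed.

Lemma flat_at_neq0l : nontrivial_type L1 ->
  flat_at (f top).1 (f bot).2 != set0.
Proof.
apply: contraPneq => /flat_at_eq0[eq_b _];
  apply: (@bot_top_trivial _ _ (f bot).1).
  by move=> z; case: (bot_le z (f bot).2).
by move=> z; rewrite -eq_b; case: (le_top z (f bot).2).
Qed.

Lemma flat_at_neq0r : nontrivial_type L2 ->
  flat_at (f bot).1 (f top).2 != set0.
Proof.
apply: contraPneq => /flat_at_eq0[_ eq_b];
  apply: (@bot_top_trivial _ _ (f bot).2).
  by move=> z; case: (bot_le (f bot).1 z).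
by move=> z; rewrite -eq_b; case: (le_top (f bot).1 z).
Qed.

Lemma flat_at_setD :
  F :\: flat_at (f top).1 (f bot).2 = flat_at (f bot).1 (f top).2.
Proof.
rewrite -[in LHS]flat_at_top flat_atU setDUl setDv set0U.
by apply/setDidPl; rewrite -setI_eq0 setIC flat_atI.
Qed.

Lemma flat_at_flatU H K : flat M H -> flat M K ->
  H \subset flat_at (f top).1 (f bot).2 ->
  K \subset flat_at (f bot).1 (f top).2 ->
  flat M (H :|: K).
Proof.
move=> fl_H fl_K sHA sKB.
have [x [y eq_H]] := flat_atP fl_H (subset_trans sHA (flat_at_subF _ _)).
have [x' [y' eq_K]] := flat_atP fl_K (subset_trans sKB (flat_at_subF _ _)).
move: sHA sKB; rewrite eq_H eq_K !sub_flat_at => /andP[_ le_y] /andP[le_x' _].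
have -> : y = (f bot).2 by apply: le_anti; rewrite le_y; case: (bot_le x y).
have -> : x' = (f bot).1 by apply: le_anti; rewrite le_x'; case: (bot_le x' y').
by rewrite -flat_atU flat_at_flat.
Qed.

End LatticeSplitting.

Lemma decomposable_flatU : lattice_decomposable M F ->
  exists A, [/\ A \subset F, A != set0, A != F, flat M A & flat M (F :\: A)]
    /\ forall H K, flat M H -> flat M K -> H \subset A -> K \subset F :\: A ->
          flat M (H :|: K).
Proof.
case=> d1 [d2 [L1 [L2 [f [nontriv1 nontriv2 [[g fK gK] le_f]]]]]].
have nA0 := flat_at_neq0l fK gK le_f nontriv1.
have nB0 := flat_at_neq0r fK gK le_f nontriv2.
have := flat_at_setD fK gK le_f; set A := (X in F :\: X) => eqB; exists A.
split; last first.
  by move=> H K fl_H fl_K; rewrite eqB; apply: (flat_at_flatU fK gK le_f).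
split; rewrite ?eqB ?flat_at_flat ?flat_at_subF //.
by apply: contra_neq nB0 => eqF; rewrite -eqB eqF setDv.
Qed.

Lemma decomposable_separates :
  lattice_decomposable M F -> exists A, separates A.
Proof.
case/decomposable_flatU => A [[sAF nA0 nAF fA fB] fU]; exists A.
rewrite /separates sAF nA0 nAF /= -[in leqRHS](setUD_sub sAF).
suff rkU X : X \subset A -> M X + M (F :\: A) <= M (X :|: F :\: A)
  by apply: rkU.
have [n] := ubnP #|X|; elim: n X => // n IHn X ltX sXA.
have [->|[e eX]] := set_0Vmem X; first by rewrite rk0 set0U.
have sX'A : X :\ e \subset A by apply: subset_trans sXA; apply: subD1set.
have {IHn} rkX' : M (X :\ e) + M (F :\: A) <= M (X :\ e :|: F :\: A).
  by apply: IHn => //; rewrite (cardsD1 e X) eX in ltX.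
rewrite -(setD1K eX) -setUA.
have [e_span|ne_span] := boolP (e \in span M (X :\ e)).
  have le_rk : M (e |: X :\ e) <= M (X :\ e).
    by rewrite -[leqRHS]rk_span rkS // subUset sub1set e_span sub_span.
  apply: leq_trans (leq_add le_rk (leqnn _)) (leq_trans rkX' _).
  by rewrite rkS ?subsetUr.
have fl_U : flat M (span M (X :\ e) :|: F :\: A).
  by apply: fU; rewrite ?flat_span ?span_min.
have lt_rk : M (X :\ e :|: F :\: A) < M (e |: (X :\ e :|: F :\: A)).
  apply: flat_rk_setU1 fl_U _ _; first by rewrite setSU ?sub_span.
  by rewrite inE negb_or ne_span inE (subsetP sXA).
by have := rk_setU1 M e (X :\ e); move: lt_rk rkX'; clear; lia.
Qed.

Lemma lattice_decomposableP :
  lattice_decomposable M F <-> exists A, separates A.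
Proof.
by split=> [/decomposable_separates|[A /separates_decomposable]].
Qed.

End Separators.

(** * Nested matroids with circuit-hyperplanes *)

Section NestedMatroid.

Variables (E : finType) (n : nat) (C : nat -> {set E}) (c : nat -> nat).
Hypotheses (C0 : C 0 = set0) (c0 : c 0 = 0).
Hypothesis subC : forall i j, i <= j -> C i \subset C j.
Implicit Types (A B : {set E}) (i j : nat).

Definition nested_rk A : nat := \big[minn/#|A|]_(i < n.+1) (c i + #|A :\: C i|).

Lemma nested_rk_le A i : i <= n -> nested_rk A <= c i + #|A :\: C i|.
Proof.
rewrite -ltnS => lt_i; rewrite /nested_rk -minEnat -leEnat.
exact: (bigmin_le _ (Ordinal lt_i)).
Qed.

Lemma nested_rkP A : exists2 i, i <= n & nested_rk A = c i + #|A :\: C i|.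
Proof.
apply: (big_ind (fun r => exists2 i, i <= n & r = c i + #|A :\: C i|))
  => [|r s|i _].
- by exists 0; rewrite // C0 c0 setD0.
- by rewrite /minn; case: ifP.
by exists i; rewrite // -ltnS.
Qed.

Lemma nested_rk_card A : nested_rk A <= #|A|.
Proof. by have := nested_rk_le A (leq0n n); rewrite C0 c0 setD0. Qed.

Lemma nested_rk0 : nested_rk set0 = 0.
Proof. by apply/eqP; rewrite -leqn0 -(cards0 E) nested_rk_card. Qed.

Lemma nested_rkS A B : A \subset B -> nested_rk A <= nested_rk B.
Proof.
move=> sAB; have [i le_i ->] := nested_rkP B.
apply: leq_trans (nested_rk_le A le_i) _.
by rewrite leq_add2l subset_leq_card ?setSD.
Qed.

Lemma nested_rk_submod A B :
  nested_rk (A :|: B) + nested_rk (A :&: B) <= nested_rk A + nested_rk B.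
Proof.
have [i le_i rkA] := nested_rkP A; have [j le_j rkB] := nested_rkP B.
wlog le_ij : A B i j le_i le_j rkA rkB / i <= j => [wlog_le|].
  have [le_ij|/ltnW le_ji] := leqP i j; first exact: (wlog_le A B i j).
  by rewrite setUC setIC [leqRHS]addnC; apply: (wlog_le B A j i).
have le_U := nested_rk_le (A :|: B) le_j.
have le_I := nested_rk_le (A :&: B) le_i.
have sCij e : e \in C i -> e \in C j by apply/subsetP/subC.
suff : #|(A :|: B) :\: C j| + #|(A :&: B) :\: C i|
    <= #|A :\: C i| + #|B :\: C j|.
  by move: le_U le_I; rewrite rkA rkB; clear; lia.
rewrite -cardsUI -[leqRHS]cardsUI leq_add // subset_leq_card //;
  apply/subsetP => e;
  move/implyP: (sCij e); rewrite !inE;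
  by case: (e \in A); case: (e \in B); case: (e \in C i); case: (e \in C j).
Qed.

Definition nested_matroid : matroid E :=
  Matroid nested_rk0 nested_rkS nested_rk_submod nested_rk_card.

End NestedMatroid.

Section Tightening.

Variables (E : finType) (M : matroid E) (hyps : {set {set E}}).
Implicit Types (A B P K : {set E}).

Hypothesis basis_hyps : {in hyps, forall P, #|P| = M setT /\ M P = M setT}.
Hypothesis free_hyps : {in hyps, forall P A,
  ~~ (A \subset P) -> ~~ (P \subset A) -> #|P :&: A| < M A}.
Hypothesis sep_hyps : {in hyps &, forall P K, P != K -> #|P :&: K|.+1 < M setT}.

(* Turns the bases in [hyps] into circuits and hyperplanes. *)
Definition tight_rk A : nat := M A - (A \in hyps).

Lemma tight_rk_le A : tight_rk A <= M A.
Proof. exact: leq_subr. Qed.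

Lemma tight_rk_notin A : A \notin hyps -> tight_rk A = M A.
Proof. by rewrite /tight_rk => /negbTE->; apply: subn0. Qed.

Lemma tight_rk_in P : P \in hyps -> tight_rk P = (M setT).-1.
Proof.
by move=> hP; rewrite /tight_rk hP subn1; have [_ ->] := basis_hyps hP.
Qed.

Lemma tight_rk0 : tight_rk set0 = 0.
Proof. by apply/eqP; rewrite -leqn0 -(rk0 M) tight_rk_le. Qed.

Lemma tight_rk_card A : tight_rk A <= #|A|.
Proof. exact: leq_trans (tight_rk_le A) (rk_card M A). Qed.

Lemma tight_rkS A B : A \subset B -> tight_rk A <= tight_rk B.
Proof.
move=> sAB; have [->//|neAB] := eqVneq A B.
have [hB|nhB] := boolP (B \in hyps); last first.
  by rewrite (tight_rk_notin nhB) (leq_trans (tight_rk_le A)) ?rkS.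
have : #|A| < #|B| by rewrite proper_card // properEneq neAB.
have [-> _] := basis_hyps hB; rewrite (tight_rk_in hB) => lt_A.
by apply: leq_trans (tight_rk_card A) _; rewrite -ltnS (ltn_predK lt_A).
Qed.

Lemma free_tight_rk P A : P \in hyps -> ~~ (A \subset P) -> ~~ (P \subset A) ->
  #|P :&: A| < tight_rk A.
Proof.
move=> hP nsAP nsPA; have [hA|nhA] := boolP (A \in hyps); last first.
  by rewrite tight_rk_notin ?free_hyps.
have nePA : P != A by apply: contraNneq nsAP => ->.
rewrite tight_rk_in //; have := sep_hyps hP hA nePA.
by clear; lia.
Qed.

Lemma tight_rk_submod_in P A : P \in hyps ->
  tight_rk (P :|: A) + tight_rk (P :&: A) <= tight_rk P + tight_rk A.
Proof.
move=> hP; have [sAP|nsAP] := boolP (A \subset P).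
  by rewrite (setUidPl sAP) (setIidPr sAP).
have [sPA|nsPA] := boolP (P \subset A).
  by rewrite (setUidPr sPA) (setIidPl sPA) addnC.
have lt_A := free_tight_rk hP nsAP nsPA; have := tight_rk_card (P :&: A).
have := leq_trans (tight_rk_le (P :|: A)) (rkS M (subsetT _)).
by rewrite (tight_rk_in hP); move: lt_A; clear; lia.
Qed.

Lemma tight_rk_submod A B :
  tight_rk (A :|: B) + tight_rk (A :&: B) <= tight_rk A + tight_rk B.
Proof.
have [hA|nhA] := boolP (A \in hyps); first exact: tight_rk_submod_in.
have [hB|nhB] := boolP (B \in hyps).
  by rewrite setUC setIC [leqRHS]addnC; apply: tight_rk_submod_in.
rewrite (tight_rk_notin nhA) (tight_rk_notin nhB).
apply: leq_trans (rk_submod M A B);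
exact: leq_add (tight_rk_le _) (tight_rk_le _).
Qed.

Definition tight_matroid : matroid E :=
  Matroid tight_rk0 tight_rkS tight_rk_submod tight_rk_card.

End Tightening.

Section TightenedNestedMatroid.

Variables (E : finType) (l : nat) (C : nat -> {set E}) (c : nat -> nat).
Variable hyps : {set {set E}}.
Implicit Types (A B F P K : {set E}) (e : E) (i j : nat).

Hypotheses (C0 : C 0 = set0) (c0 : c 0 = 0).
Hypothesis C_top : forall i, l < i -> C i = setT.
Hypothesis subC : forall i j, i <= j -> C i \subset C j.
Hypothesis lt_c : forall i j, i < j <= l.+1 -> c i < c j < c i + #|C j :\: C i|.
Hypotheses (l_gt0 : 0 < l) (c1_gt1 : 1 < c 1).
Hypothesis card_hyps : {in hyps, forall P, #|P| = c l.+1}.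
Hypothesis hyps_disjoint : {in hyps, forall P, [disjoint P & C l]}.
Hypothesis sep_hyps : {in hyps &, forall P K, P != K -> #|P :&: K|.+1 < c l.+1}.

Local Notation N := (nested_matroid l.+1 C0 c0 subC).

Lemma nested_leq_c i j : i <= j -> j <= l.+1 -> c i <= c j.
Proof.
rewrite leq_eqVlt => /predU1P[->//|lt_ij le_j].
by have /andP[/ltnW] := lt_c (introT andP (conj lt_ij le_j)).
Qed.

Lemma nested_c_gt1 i : 0 < i <= l.+1 -> 1 < c i.
Proof.
by case/andP=> i_gt0 le_i;
  apply: leq_trans c1_gt1 (nested_leq_c i_gt0 le_i).
Qed.

Lemma nested_rk_level A : exists2 j, j <= l.+1 & N A = c j + #|A :\: C j|.
Proof. exact: nested_rkP. Qed.

Lemma nested_rk_flag i : i <= l.+1 -> N (C i) = c i.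
Proof.
move=> le_i; apply/eqP; rewrite eqn_leq; apply/andP; split.
  by have := nested_rk_le C c (C i) le_i; rewrite setDv cards0 addn0.
have [j le_j ->] := nested_rk_level (C i).
have [le_ij|lt_ji] := leqP i j;
  first by rewrite (leq_trans (nested_leq_c le_ij le_j)) ?leq_addr.
by have /andP[_ /ltnW] := lt_c (introT andP (conj lt_ji le_i)).
Qed.

Lemma nested_rkT : N setT = c l.+1.
Proof. by rewrite -(C_top (ltnSn l)) nested_rk_flag. Qed.

Lemma nested_rk_small A : #|A| <= c 1 -> N A = #|A|.
Proof.
move=> leA; apply/eqP; rewrite eqn_leq rk_card andTb.
have [[|j] le_j ->] := nested_rk_level A; first by rewrite C0 setD0 leq_addl.
exact: leq_trans leA (leq_trans (nested_leq_c _ le_j) (leq_addr _ _)).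
Qed.

Lemma nested_rk_gt0 A : A != set0 -> 0 < N A.
Proof.
rewrite -card_gt0 => A_gt0; have [[|j] le_j ->] := nested_rk_level A.
  by rewrite C0 setD0 addn_gt0 A_gt0 orbT.
by rewrite addn_gt0 ltnW // nested_c_gt1.
Qed.

Lemma hyp_setD P j : P \in hyps -> j <= l -> P :\: C j = P.
Proof.
by move=> /hyps_disjoint dPl le_j; apply/setDidPl/(disjointWr (subC le_j)).
Qed.

Lemma nested_basis_hyps : {in hyps, forall P, #|P| = N setT /\ N P = N setT}.
Proof.
move=> P hP; rewrite nested_rkT card_hyps //; split=> //; apply/eqP.
rewrite eqn_leq -{1}nested_rkT rkS ?subsetT // andTb.
have [j le_j ->] := nested_rk_level P.
move: le_j; rewrite leq_eqVlt => /predU1P[->|le_j]; first exact: leq_addr.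
by rewrite hyp_setD // card_hyps // leq_addl.
Qed.

Lemma nested_free_hyps : {in hyps, forall P A,
  ~~ (A \subset P) -> ~~ (P \subset A) -> #|P :&: A| < N A}.
Proof.
move=> P hP A nsAP nsPA.
have ltA : #|P :&: A| < #|A|.
  by rewrite proper_card // properE subsetIr subsetI subxx andbT.
have ltP : #|P :&: A| < #|P|.
  by rewrite proper_card // properE subsetIl subsetI subxx.
have [j le_j ->] := nested_rk_level A.
case: j le_j => [|j]; first by rewrite C0 setD0 (leq_trans ltA) ?leq_addl.
rewrite leq_eqVlt ltnS => /predU1P[->|le_j].
  by rewrite -(card_hyps hP) (leq_trans ltP) ?leq_addr.
have sPA : P :&: A \subset A :\: C j.+1.
  by rewrite -(hyp_setD hP le_j) setIC setIDA setSD ?subsetIl.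
rewrite -add1n leq_add ?(subset_leq_card sPA) //.
exact/ltnW/nested_c_gt1/leqW.
Qed.

Lemma nested_sep_hyps : {in hyps &, forall P K,
  P != K -> #|P :&: K|.+1 < N setT}.
Proof. by rewrite nested_rkT. Qed.

Definition tight_nested_matroid : matroid E :=
  tight_matroid nested_basis_hyps nested_free_hyps nested_sep_hyps.

Local Notation M := tight_nested_matroid.

Lemma tight_nested_rk_le A : M A <= N A.
Proof. exact: tight_rk_le. Qed.

Lemma tight_nested_notin A : A \notin hyps -> M A = N A.
Proof. exact: tight_rk_notin. Qed.

Lemma tight_nested_hyp P : P \in hyps -> M P = (c l.+1).-1.
Proof. by rewrite -nested_rkT; apply/tight_rk_in/nested_basis_hyps. Qed.

Lemma nested_c_top_gt2 : 2 < c l.+1.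
Proof.
have /andP[lt_c1 _] := lt_c (introT andP (conj (l_gt0 : 1 < l.+1) (leqnn _))).
exact: leq_ltn_trans c1_gt1 lt_c1.
Qed.

Lemma flag_notin_hyps i A : 0 < i <= l.+1 -> C i \subset A -> A \notin hyps.
Proof.
move=> /[dup] /andP[_ le_i] /lt_c/andP[_]; rewrite c0 C0 setD0 => lt_ci sCA.
apply: contraTN lt_ci => hA; rewrite -leqNgt -(nested_rk_flag le_i).
have [cardA rkA] := nested_basis_hyps hA.
by rewrite (sub_indep sCA) // rkA cardA.
Qed.

Lemma tight_nested_flag i : 0 < i <= l.+1 -> M (C i) = c i.
Proof.
move=> /[dup] /andP[_ le_i] /flag_notin_hyps nC.
by rewrite tight_nested_notin ?nC ?nested_rk_flag.
Qed.

Lemma tight_nestedT : M setT = c l.+1.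
Proof. by rewrite -(C_top (ltnSn l)) tight_nested_flag ?leqnn. Qed.

Lemma tight_nested_small A : #|A| <= 2 -> M A = #|A|.
Proof.
move=> leA; rewrite tight_nested_notin ?nested_rk_small ?(leq_trans leA) //.
apply: contraTN leA => /card_hyps->; rewrite -ltnNge; exact: nested_c_top_gt2.
Qed.

Lemma tight_nested_simple : simple_matroid M.
Proof.
split=> [|e]; apply/forallP => x; apply/implyP; rewrite inE => ne_x.
  by rewrite setU0 !tight_nested_small ?cards1 ?cards0.
by rewrite !tight_nested_small ?cards2 ?cards1 ?ne_x.
Qed.

Lemma tight_nested_flag_flat i : 0 < i -> flat M (C i).
Proof.
move=> i_gt0; have [le_i|/C_top->] := leqP i l; last exact: flatT.
have rng_i : 0 < i <= l.+1 by rewrite i_gt0 leqW.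
apply/forallP => e; apply/implyP => neC.
rewrite tight_nested_flag // tight_nested_notin ?(flag_notin_hyps rng_i)
  ?subsetUr //.
have [j le_j ->] := nested_rk_level (e |: C i).
case: (ltngtP i j) => [lt_ij|lt_ji|<-].
- have /andP[lt_cij _] := lt_c (introT andP (conj lt_ij le_j)).
  exact: leq_trans lt_cij (leq_addr _ _).
- have /andP[_ lt_cji] := lt_c (introT andP (conj lt_ji (leqW le_i))).
  by apply: leq_trans lt_cji _; rewrite leq_add2l subset_leq_card ?setSD
    ?subsetUr.
rewrite setDUl setDv setU0 (setDidPl _) ?cards1 ?addn1 //.
by rewrite disjoints1.
Qed.

Lemma tight_nested_hyp_flat P : P \in hyps -> flat M P.
Proof.
move=> hP; apply/forallP => e; apply/implyP => neP.
have [cardP rkP] := nested_basis_hyps hP.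
rewrite tight_nested_hyp // tight_nested_notin.
  by rewrite (leq_trans _ (rkS N (subsetUr _ P))) // rkP nested_rkT
    (ltn_predK nested_c_top_gt2).
by apply/negP => /card_hyps; rewrite cardsU1 neP card_hyps //; clear; lia.
Qed.

Lemma nested_rk_flag_setU i A B : i <= l.+1 -> A :|: B = C i ->
  A != set0 -> B != set0 -> c i < N A + N B.
Proof.
move=> le_i eqU nA0 nB0.
have [j le_j rkA] := nested_rk_level A; have [k le_k rkB] := nested_rk_level B.
wlog le_jk : A B j k eqU nA0 nB0 le_j le_k rkA rkB / j <= k => [wlog_le|].
  have [le_jk|/ltnW le_kj] := leqP j k; first exact: (wlog_le A B j k).
  by rewrite addnC; apply: (wlog_le B A k j) => //; rewrite setUC.
have [le_ik|lt_ki] := leqP i k.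
  have := nested_rk_gt0 nA0; have := nested_leq_c le_ik le_k.
  by rewrite rkB; clear; lia.
have /andP[_ lt_ci] := lt_c (introT andP (conj lt_ki le_i)).
have sD : C i :\: C k \subset (A :\: C j) :|: (B :\: C k).
  by rewrite -eqU setDUl setUSS ?setDS ?subC.
have [le_U _] := leq_card_setU (A :\: C j) (B :\: C k).
have := subset_leq_card sD; rewrite rkA rkB; move: lt_ci le_U; clear; lia.
Qed.

Lemma hyp_not_separates_flag i P : 0 < i <= l.+1 -> P \in hyps ->
  ~~ separates M (C i) P.
Proof.
move=> /andP[i_gt0 le_i] hP; apply/negP => /and4P[_ _ _].
have sC1 : C 1 \subset C i :\: P.
  rewrite subsetD subC //= disjoint_sym.
  exact: disjointWr (subC l_gt0) (hyps_disjoint hP).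
have := rkS M sC1; rewrite !tight_nested_flag ?i_gt0 // (tight_nested_hyp hP).
have := nested_leq_c le_i (leqnn _); have := nested_c_top_gt2; have := c1_gt1.
by clear; lia.
Qed.

Lemma flag_not_separates i A : 0 < i <= l.+1 -> ~~ separates M (C i) A.
Proof.
move=> rng_i; apply/negP => sepA; have sepD := separates_setD sepA.
have nhA : A \notin hyps.
  by apply: contraTN sepA => /(hyp_not_separates_flag rng_i).
have nhD : C i :\: A \notin hyps.
  by apply: contraTN sepD => /(hyp_not_separates_flag rng_i).
have [sAC nA0 _ le_rk] := and4P sepA; have [_ nD0 _ _] := and4P sepD.
have /andP[_ le_i] := rng_i;
have := nested_rk_flag_setU le_i (setUD_sub sAC) nA0 nD0.
by rewrite -(tight_nested_flag rng_i) -!tight_nested_notin // ltnNge le_rk.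
Qed.

Lemma hyp_not_separates P A : P \in hyps -> ~~ separates M P A.
Proof.
move=> hP; apply/negP => sepA; have [sAP nA0 nAP] := and4P sepA.
have [_ _ nDP _] := and4P (separates_setD sepA).
have [cardP rkP] := nested_basis_hyps hP.
have indep B : B \subset P -> B != P -> M B = #|B|.
  move=> sBP neBP; rewrite tight_nested_notin;
    first by rewrite (sub_indep sBP) // rkP cardP.
  apply/negP => /card_hyps cardB; have := proper_card (_ : B \proper P).
  by rewrite properEneq neBP sBP cardB card_hyps // ltnn => /(_ isT).
rewrite (indep A) // (indep (P :\: A)) ?subsetDl //.
rewrite tight_nested_hyp // cardsD (setIidPr sAP) subnKC ?subset_leq_card //
  card_hyps //.
by have := nested_c_top_gt2; clear; lia.
Qed.

Lemma nonseparable_atoms_flag_hyps F : flat M F -> F != set0 ->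
  (forall A, ~~ separates M F A) ->
  F \in atoms_flag_hyps l (fun i => C i.+1) hyps.
Proof.
move=> fF nF0 nsepF; have [hF|nhF] := boolP (F \in hyps);
  first by rewrite !inE hF orbT.
have rkF : M F = N F := tight_nested_notin nhF.
have [k le_k rkNF] := nested_rk_level F.
have [eqF|[e /setDP[eF neC]]] := set_0Vmem (F :\: C k).
  have sFC : F \subset C k by rewrite -setD_eq0 eqF.
  case: k le_k sFC rkNF {eqF} => [|k] le_k sFC rkNF.
    by rewrite C0 subset0 (negbTE nF0) in sFC.
  have -> : F = C k.+1.
    apply: flat_eq fF sFC _; rewrite tight_nested_flag // rkF rkNF.
    by rewrite leq_addr.
  apply/setUP; left; apply/setUP; right; apply/imsetP.
  by exists (@Ordinal l.+1 k le_k).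
have [->|neF] := eqVneq F [set e].
  by apply/setUP; left; apply/setUP; left; apply: imset_f.
case/negP: (nsepF [set e]); rewrite /separates sub1set eF.
rewrite -card_gt0 cards1 eq_sym neF !andTb.
rewrite tight_nested_small ?cards1 // rkF rkNF.
rewrite (cardsD1 e (F :\: C k)) inE neC eF addnCA leq_add2l.
apply: leq_trans (tight_nested_rk_le _) _.
apply: leq_trans (nested_rk_le C c _ le_k) _.
by rewrite setDDl setUC -setDDl.
Qed.

Lemma tight_nested_G_min : G_min M = atoms_flag_hyps l (fun i => C i.+1) hyps.
Proof.
have nsep_nondec F : flat M F -> (forall A, ~~ separates M F A) ->
    ~ lattice_decomposable M F.
  by move=> fF nsepF /(lattice_decomposableP tight_nested_simple fF)[A];
    apply/negP.
apply/setP => F; rewrite inE; apply/and3P/idP => [[fF nF0 /asboolP ndecF]|GF].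
  apply: nonseparable_atoms_flag_hyps => // A; apply/negP => sepA; apply: ndecF.
  by apply/(lattice_decomposableP tight_nested_simple fF); exists A.
suff [fF F_gt0 nsepF] : [/\ flat M F, 0 < M F & forall A, ~~ separates M F A].
  split; rewrite ?fF //; last exact/asboolP/nsep_nondec.
  by apply: contraTneq F_gt0 => ->; rewrite rk0.
case/setUP: GF => [/setUP[]/imsetP[x _ ->]|hF].
- split; [by case: tight_nested_simple | |].
    by rewrite tight_nested_small cards1.
  move=> A; apply/negP => /and4P[]; rewrite subset1.
  by case/orP => /eqP->; rewrite eqxx.
- split; [exact: tight_nested_flag_flat | |]; last first.
    by move=> A; apply/flag_not_separates/ltn_ord.
  rewrite tight_nested_flag; last exact: ltn_ord.
  exact/ltnW/nested_c_gt1/ltn_ord.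
split; [exact: tight_nested_hyp_flat | | by move=> A; apply: hyp_not_separates].
by rewrite tight_nested_hyp //; have := nested_c_top_gt2; clear; lia.
Qed.

Lemma tight_nested_chow_hilbert :
  chow_hilbert M (G_min M) (flag_hilbert M l (fun i => C i.+1) hyps).
Proof.
have rkC i : i <= l -> M (C i.+1) = c i.+1.
  by move=> le_i; apply: tight_nested_flag.
rewrite tight_nested_G_min; apply: chow_hilbert_flag
  => [||i||i lt_i|i|P|P hP|P].
- exact: tight_nested_simple.
- by rewrite tight_nestedT nested_c_top_gt2.
- exact: tight_nested_flag_flat.
- by rewrite rkC.
- have /andP[lt_ci _] := @lt_c i.+1 i.+2 (introT andP (conj (ltnSn _) lt_i)).
  rewrite properE subC // andTb; apply: contraTN lt_ci => /(rkS M).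
  by rewrite !rkC ?(ltnW lt_i) // -leqNgt.
- by move=> le_i; apply: C_top.
- exact: tight_nested_hyp_flat.
- by rewrite tight_nestedT tight_nested_hyp // (ltn_predK nested_c_top_gt2).
by apply: contraL => /flag_notin_hyps->.
Qed.

End TightenedNestedMatroid.

(** * Building sets of Boolean matroids *)

Section BooleanBuilding.

Variable n : nat.
Local Notation U := (boolean_matroid n).
Implicit Types (A B F H K : {set 'I_n}).

Lemma boolean_flat F : flat U F.
Proof. by apply/forallP => e; apply/implyP => eF /=; rewrite cardsU1 eF. Qed.

Lemma boolean_simple : simple_matroid U.
Proof. by split=> [|e]; apply: boolean_flat. Qed.

Lemma boolean_span A : span U A = A.
Proof. exact/span_flat/boolean_flat. Qed.

Variable G : {set {set 'I_n}}.
Hypotheses (G0 : set0 \notin G) (G1 : forall e, [set e] \in G).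
Hypothesis GU : {in G &, forall A B, A :&: B != set0 -> A :|: B \in G}.

Local Notation factors F := (maximal_elts (restrict_le G F)).

Lemma maximal_eltsP F H : H \in factors F ->
  [/\ H \in G, H \subset F
    & forall K, K \in G -> K \subset F -> H \subset K -> K = H].
Proof.
rewrite inE => /andP[]; rewrite inE => /andP[HG HF] /forallP max; split => //.
move=> K KG KF sHK; have := max K; rewrite inE KG KF sHK /=.
by move/eqP.
Qed.

Lemma maximal_elts_inj F H K e :
  H \in factors F -> K \in factors F -> e \in H -> e \in K -> H = K.
Proof.
move=> /maximal_eltsP[HG HF maxH] /maximal_eltsP[KG KF maxK] eH eK.
have UG : H :|: K \in G by apply: GU => //; apply/set0Pn; exists e;
  rewrite inE eH.
have UF : H :|: K \subset F by rewrite subUset HF.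
by rewrite -(maxH _ UG UF (subsetUl _ _)) -[RHS](maxK _ UG UF (subsetUr _ _)).
Qed.

Lemma maximal_elts_cover F e : e \in F -> exists2 H, H \in factors F & e \in H.
Proof.
move=> eF; pose Q H := (H \in restrict_le G F) && (e \in H).
have Q1 : Q [set e] by rewrite /Q !inE G1 sub1set eF eqxx.
case: (arg_maxnP (fun H : {set 'I_n} => #|H|) Q1) => H /andP[HF eH] max.
exists H => //; rewrite inE HF; apply/forallP => K; apply/implyP => KF.
apply/implyP => sHK; rewrite eq_sym eqEcard sHK; apply: max.
by rewrite /Q KF (subsetP sHK).
Qed.

Section Join.

Variable F : {set 'I_n}.

Lemma bigcup_factorI (u : interval_prod U G F) (H : factor G F) :
  (\bigcup_K val (u K)) :&: val H = val (u H).
Proof.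
apply/setP => e; rewrite inE; apply/andP/idP => [[/bigcupP[K _ eu] eH]|eu].
  have eK : e \in val K by apply: subsetP eu; have /andP[] := valP (u K).
  have eqK : val K = val H := maximal_elts_inj (valP K) (valP H) eK eH.
  by move/val_inj: eqK eu => ->.
split; first by apply/bigcupP; exists H.
by apply: subsetP eu; have /andP[] := valP (u H).
Qed.

Fact restrict_subproof K (H : factor G F) : below U (val H) (K :&: val H).
Proof. by rewrite /below boolean_flat subsetIr. Qed.

Definition restrict_map (K : interval U F) : interval_prod U G F :=
  [ffun H : factor G F =>
    (exist _ (val K :&: val H) (restrict_subproof (val K) H) :
      interval U (val H))].

Lemma boolean_join_iso (fF : flat U F) :
  lattice_iso (@le_interval_prod _ U G F) (@le_interval _ U F) (join_map fF).
Proof.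
split=> [|u v].
  exists restrict_map => [u|K].
    apply/ffunP => H; rewrite ffunE; apply: val_inj => /=.
    by rewrite boolean_span bigcup_factorI.
  apply: val_inj => /=; rewrite boolean_span; apply/setP => e.
  apply/bigcupP/idP => [[H _]|eK]; first by rewrite ffunE inE => /andP[].
  have eF : e \in F by apply: subsetP eK; have /andP[] := valP K.
  have [H HF eH] := maximal_elts_cover eF.
  by exists (exist _ H HF); rewrite // ffunE inE eK.
rewrite /le_interval /= !boolean_span; apply/idP/forallP => [suv H|suv].
  by rewrite /le_interval -!bigcup_factorI setSI.
apply/bigcupsP => H _; have /subset_trans := suv H; apply.
exact: (bigcup_sup H).
Qed.

End Join.

Lemma boolean_building_set : building_set U G.
Proof.
split=> [H HG|F fF|F _].
- by split; [exact: boolean_flat | apply: contraTneq HG => ->].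
- exact: boolean_join_iso.
apply: card_partition; apply/and3P; split.
- apply/eqP/setP => e; apply/bigcupP/idP
    => [[H /maximal_eltsP[_ /subsetP sHF _] /sHF]//|].
  by case/maximal_elts_cover => H; exists H.
- apply/trivIsetP => H K HF KF; apply: contraR => /pred0Pn[e /andP[eH eK]].
  exact/eqP/(maximal_elts_inj HF KF eH eK).
- by apply/negP => /maximal_eltsP[]; rewrite (negbTE G0).
Qed.

End BooleanBuilding.

Lemma atoms_flag_coatoms_setU (E : finType) (l : nat) (R : nat -> {set E})
    (hyps : {set {set E}}) :
  (forall i j, i <= j -> R i \subset R j) -> R l = setT ->
  {in hyps, forall P, exists x, P = [set~ x]} ->
  {in atoms_flag_hyps l R hyps &, forall A B,
    A :&: B != set0 -> A :|: B \in atoms_flag_hyps l R hyps}.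
Proof.
move=> subR R_top coatoms; set G := atoms_flag_hyps l R hyps.
have TG : setT \in G.
  apply/setUP; left; apply/setUP; right; rewrite -R_top; apply/imsetP.
  by exists ord_max.
have coatomU P A : P \in hyps -> P :|: A \in G.
  move=> hP; have [x defP] := coatoms P hP; have [xA|nxA] := boolP (x \in A).
    rewrite (_ : P :|: A = setT) //; apply/setP => e; rewrite defP !inE.
    by case: eqP => // ->; rewrite xA.
  rewrite (setUidPl _) ?inE ?hP ?orbT // defP; apply/subsetP => e eA.
  by rewrite !inE; apply: contraNneq nxA => <-.
have comparable_setU A B :
    A \in G -> B \in G -> (A \subset B) || (B \subset A) ->
    A :|: B \in G.
  by move=> AG BG /orP[/setUidPr->|/setUidPl->].
have atom_sub e A : [set e] :&: A != set0 -> [set e] \subset A.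
  by case/set0Pn => x; rewrite !inE sub1set => /andP[/eqP->].
move=> A B AG BG meetAB.
case/setUP: (AG) => [AG'|/coatomU//]; case/setUP: (BG) => [BG'|hB].
  apply: comparable_setU => //.
  case/setUP: AG' => /imsetP[i _ eqA]; first by rewrite eqA atom_sub -?eqA.
  case/setUP: BG' => /imsetP[j _ eqB];
    first by rewrite eqB atom_sub ?orbT // -eqB setIC.
  by rewrite eqA eqB; case: (leqP i j) => [/subR->//|/ltnW/subR->];
    rewrite orbT.
by rewrite setUC coatomU.
Qed.

Section InitialSegments.

Variable n : nat.

Definition initial (m : nat) : {set 'I_n} := [set x : 'I_n | x < m].

Lemma card_initial m : m <= n -> #|initial m| = m.
Proof.
by move=> le_m; rewrite -sum1dep_card (big_ord_narrow le_m) sum1_card card_ord.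
Qed.

Lemma initial_sub m1 m2 : m1 <= m2 -> initial m1 \subset initial m2.
Proof.
by move=> le_m; apply/subsetP => x; rewrite !inE => /leq_trans;
  apply.
Qed.

Lemma initial0 : initial 0 = set0.
Proof. by apply/setP => x; rewrite !inE. Qed.

Lemma initial_top m : n <= m -> initial m = setT.
Proof.
by move=> le_n; apply/setP => x; rewrite !inE (leq_trans (ltn_ord x)).
Qed.

Lemma card_initialD m1 m2 : m1 <= m2 -> m2 <= n ->
  #|initial m2 :\: initial m1| = m2 - m1.
Proof.
move=> le_m12 le_m2; rewrite cardsD (setIidPr (initial_sub le_m12)).
by rewrite !card_initial // (leq_trans le_m12).
Qed.

End InitialSegments.

(** * The counterexamples *)

Section MatroidExample.

Definition example_chain i : {set 'I_79} := initial 79 (nth 79 [:: 0; 5; 9] i).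

Definition example_capacity i : nat := nth 10 [:: 0; 4; 7] i.

Definition example_circuit (k : 'I_7) : {set 'I_79} :=
  initial 79 (19 + 10 * k) :\: initial 79 (9 + 10 * k).

Definition example_circuits : {set {set 'I_79}} :=
  [set example_circuit k | k : 'I_7].

Lemma example_chain_sub i j : i <= j -> example_chain i \subset example_chain j.
Proof.
move=> le_ij; apply: initial_sub.
by case: i j le_ij => [|[|[|i]]] [|[|[|j]]]; rewrite /= ?nth_nil.
Qed.

Lemma example_capacity_lt i j : i < j <= 3 ->
  example_capacity i < example_capacity j
    < example_capacity i + #|example_chain j :\: example_chain i|.
Proof.
move=> /andP[+ le_j3]; case: j le_j3 => [|[|[|[|j]]]] // _.
all: by case: i => [|[|[|i]]] //= _; rewrite card_initialD.
Qed.

Lemma mem_example_circuit k x :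
  (x \in example_circuit k) = (9 + 10 * k <= x < 19 + 10 * k).
Proof. by rewrite !inE -leqNgt. Qed.

Lemma example_circuit_disjoint k k' : k != k' ->
  example_circuit k :&: example_circuit k' = set0.
Proof.
rewrite -val_eqE /= => ne_k; apply/setP => x;
  rewrite inE in_set0 !mem_example_circuit.
by lia.
Qed.

Lemma card_example_circuit k : #|example_circuit k| = 10.
Proof. by rewrite card_initialD; have := ltn_ord k; lia. Qed.

Lemma example_circuit_inj : injective example_circuit.
Proof.
move=> k k' eq_k; apply/eqP; apply: contraT => /example_circuit_disjoint.
by rewrite eq_k setIid => eq0; have := card_example_circuit k';
  rewrite eq0 cards0.
Qed.

Lemma G_min_not_log_concave :
  exists (E : finType) (M : matroid E) (h : {poly nat}),
    [/\ loopless M, chow_hilbert M (G_min M) h & ~ log_concave h].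
Proof.
have C0 : example_chain 0 = set0 := initial0 79.
have C_top i : 2 < i -> example_chain i = setT.
  by case: i => [|[|[|i]]] //= _; rewrite /example_chain /= nth_nil initial_top.
have c1_gt1 : 1 < example_capacity 1 by [].
have card_hyps : {in example_circuits, forall P : {set _},
    #|P| = example_capacity 3}.
  by move=> _ /imsetP[k _ ->]; apply: card_example_circuit.
have hyps_disjoint : {in example_circuits, forall P : {set _},
    [disjoint P & example_chain 2]}.
  move=> _ /imsetP[k _ ->]; rewrite -setI_eq0; apply/eqP/setP => x.
  by rewrite inE in_set0 mem_example_circuit inE /=; lia.
have sep_hyps : {in example_circuits &, forall P K : {set _},
    P != K -> #|P :&: K|.+1 < example_capacity 3}.
  move=> _ _ /imsetP[k _ ->] /imsetP[k' _ ->];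
    rewrite (inj_eq example_circuit_inj).
  by move/example_circuit_disjoint->; rewrite cards0.
pose M := tight_nested_matroid C0 (erefl 0) C_top example_chain_sub
  example_capacity_lt c1_gt1 card_hyps hyps_disjoint sep_hyps.
have rkM i : 0 < i <= 3 -> M (example_chain i) = example_capacity i.
  exact: tight_nested_flag.
exists _, M, (flag_hilbert M 2 (fun i => example_chain i.+1) example_circuits);
  split.
- by case: (tight_nested_simple C0 (erefl 0) C_top example_chain_sub
    example_capacity_lt isT c1_gt1 card_hyps hyps_disjoint sep_hyps).
- exact: tight_nested_chow_hilbert.
apply: flag_hilbert_not_log_concave; rewrite ?rkM ?C_top //.
by rewrite card_imset ?card_ord //; apply: example_circuit_inj.
Qed.

End MatroidExample.

Section BooleanExample.

Variable n : nat.
Hypothesis n_ge13 : 13 <= n.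
Local Notation U := (boolean_matroid n).

Definition boolean_flag i : {set 'I_n} := initial n (n - 3 * (2 - i)).

Definition boolean_coatoms : {set {set 'I_n}} :=
  [set [set~ x] | x in initial n 7].

Lemma card_boolean_coatoms : #|boolean_coatoms| = 7.
Proof.
rewrite card_imset ?card_initial ?(leq_trans _ n_ge13) // => x y.
by move/(congr1 (@setC _)); rewrite !setCK; apply: set1_inj.
Qed.

Lemma boolean_flag_rk i : U (boolean_flag i) = n - 3 * (2 - i).
Proof. by rewrite /= card_initial ?leq_subr. Qed.

Lemma boolean_flag_sub i j : i <= j -> boolean_flag i \subset boolean_flag j.
Proof. by move=> le_ij; apply: initial_sub; lia. Qed.

Lemma boolean_flag_top i : 2 <= i -> boolean_flag i = setT.
Proof. by move=> ge2; apply: initial_top; lia. Qed.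

Lemma boolean_flag_building_set :
  building_set U (atoms_flag_hyps 2 boolean_flag boolean_coatoms).
Proof.
apply: boolean_building_set => [|e|]; first last.
- apply: atoms_flag_coatoms_setU;
    [exact: boolean_flag_sub|exact: boolean_flag_top|].
  by move=> _ /imsetP[x _ ->]; exists x.
- by apply/setUP; left; apply/setUP; left; apply: imset_f.
apply/negP => /setUP[/setUP[]|] /imsetP[x x_in] /esym/eqP; rewrite -cards_eq0.
- by rewrite cards1.
- by have := boolean_flag_rk x; rewrite /= => ->; lia.
by rewrite cardsC1 card_ord; lia.
Qed.

Lemma boolean_flag_chow_hilbert :
  chow_hilbert U (atoms_flag_hyps 2 boolean_flag boolean_coatoms)
    (flag_hilbert U 2 boolean_flag boolean_coatoms).
Proof.
have rkT : U setT = n by rewrite /= cardsT card_ord.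
apply: chow_hilbert_flag
  => [||i||i lt_i|i|P _|_ /imsetP[x _ ->]|_ /imsetP[x lt_x ->]].
- exact: boolean_simple.
- by rewrite rkT (leq_trans _ n_ge13).
- exact: boolean_flat.
- by rewrite boolean_flag_rk; lia.
- rewrite properEcard boolean_flag_sub // -[#|boolean_flag i|]/(U _)
    -[#|boolean_flag i.+1|]/(U _).
  by rewrite !boolean_flag_rk; lia.
- exact: boolean_flag_top.
- exact: boolean_flat.
- by rewrite rkT /= cardsC1 card_ord; lia.
apply/subsetPn; exists x; rewrite !inE ?eqxx //=.
by rewrite inE in lt_x; lia.
Qed.

Lemma boolean_not_log_concave : exists (G : {set {set 'I_n}}) (h : {poly nat}),
  [/\ building_set U G, chow_hilbert U G h & ~ log_concave h].
Proof.
exists (atoms_flag_hyps 2 boolean_flag boolean_coatoms),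
  (flag_hilbert U 2 boolean_flag boolean_coatoms).
split; [exact: boolean_flag_building_set | exact: boolean_flag_chow_hilbert |].
by apply: flag_hilbert_not_log_concave;
  rewrite ?boolean_flag_rk ?boolean_flag_top ?card_boolean_coatoms //; lia.
Qed.

End BooleanExample.

Theorem theorem1p6 :
  (exists (E : finType) (M : matroid E) (h : {poly nat}),
     [/\ loopless M, chow_hilbert M (G_min M) h & ~ log_concave h])
  /\
  (exists N : nat, forall n : nat, N <= n ->
     exists (G : {set {set 'I_n}}) (h : {poly nat}),
       [/\ building_set (boolean_matroid n) G,
           chow_hilbert (boolean_matroid n) G h
         & ~ log_concave h]).
Proof.
split; first exact: G_min_not_log_concave.
by exists 13; apply: boolean_not_log_concave.
Qed.
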